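(* Let $A\in 2^\omega$. The following are equivalent: (1) Each $1$-random real is $A$-random (that is, $A$ is low for random). (2) For each $\Pi^\mu_1$ class $Q$ consisting entirely of $1$-random reals, there exist $\sigma\in 2^{<\omega}$ and $n\in\omega$ such that $Q\cap[\sigma]\neq\emptyset$ but $Q\cap S^A_n\cap[\sigma]=\emptyset$. (3) For some $n$, $\overline{S^A_n}$ has a $\Pi^\mu_1$ subclass. (4) For each Martin-Löf test $\{V^A_n\}_{n\in\omega}$ relative to $A$, there exists an $n$ such that $\overline{V^A_n}$ has a $\Pi^\mu_1$ subclass. (5) For each $\Pi^\mu_1(A)$ class $Q$ there exists an $n\ge 1$ such that $Q^n$ has a $\Pi^\mu_1$ subclass. (6) Each $\Pi^\mu_1(A)$ class has a $\Pi^\mu_1$ subclass. (7) Some $\Pi^\mu_1(A)$ class consisting entirely of $A$-random reals has a $\Pi^\mu_1$ subclass. (8) The class of $A$-random reals has a $\Pi^\mu_1$ subclass.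
   Context: Reals are elements of $2^\omega$; $\mu$ is the uniform (fair-coin) measure on $2^\omega$; $[\sigma]$ is the clopen set of all $X\in 2^\omega$ extending $\sigma\in 2^{<\omega}$; $X\restriction m$ is the length-$m$ initial segment of $X$; $\overline{U}=2^\omega\setminus U$. A subclass of a class is a subset of it. A $\Sigma^\mu_1$ class is a $\Sigma^0_1$ (effectively open) class of measure $<1$; a $\Pi^\mu_1$ class is the complement of a $\Sigma^\mu_1$ class, i.e. a $\Pi^0_1$ class of positive measure. $\Sigma^\mu_1(A)$ and $\Pi^\mu_1(A)$ are the relativizations to the oracle $A$. A Martin-Löf test relative to $A$ is a sequence $\{V^A_n\}_{n\in\omega}$ of uniformly $\Sigma^0_1(A)$ classes with $\mu V^A_n\le 2^{-n}$ for all $n$. A real is $A$-random if it is Martin-Löf random relative to $A$, i.e. it lies outside $\bigcap_n V^A_n$ for every Martin-Löf test relative to $A$; $1$-random means Martin-Löf random (without oracle). $K^A$ is prefix-free Kolmogorov complexity relative to $A$ (with respect to a fixed universal prefix-free oracle machine), and $S^A_n=\{X\in 2^\omega:\exists m\ K^A(X\restriction m)\le m-n\}$. Powers: if $U=\bigcup\{[\sigma]:\sigma\in\hat U\}$ and $V=\bigcup\{[\tau]:\tau\in\hat V\}$ with $\hat U,\hat V$ prefix-free sets of strings, then $UV=\bigcup\{[\sigma\tau]:\sigma\in\hat U,\ \tau\in\hat V\}$, where $\sigma\tau$ is concatenation; the product depends on $\hat U,\hat V$, so for a $\Sigma^0_1(A)$ class $U$ one implicitly fixes a suitable prefix-free set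 $\hat U$, recursively enumerable in $A$, generating $U$. Put $U^1=U$ and $U^n=U^{n-1}U$ (generated by the concatenations of $n$ elements of $\hat U$). For a closed class $Q$, $Q^n$ is defined by $\overline{Q^n}=(\overline{Q})^n$, using the fixed generating set of the open class $\overline{Q}$. *)

(* Defs.v *)
From HB Require Import structures.
From mathcomp Require Import all_boot all_order all_algebra.
From mathcomp Require Import all_classical all_reals all_analysis.

Set Implicit Arguments.
Unset Strict Implicit.
Unset Printing Implicit Defensive.

Local Open Scope classical_set_scope.

Notation string := (seq bool).

(** * Partial recursive functions relative to an oracle *)

(** Programs for the partial recursive functionals of Kleene. Arities are not
    tracked: a program acts on a list of naturals, missing arguments are read
    as [0] and superfluous ones are ignored. *)
Inductive prog : Type :=
| Zero
| Succ
| Proj of nat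
| Query
| Comp of prog & seq prog
| PrimRec of prog & prog
| Mu of prog.

(** [eval A f v y]: with oracle [A], the program [f] halts on input [v] with
    output [y]. In [PrimRec f g] the recursion is on the first argument: [g]
    is given the predecessor, the previous value and the parameters. [Mu f]
    returns the least [y] with [f (y :: v) = 0], where [f (k :: v)] must be
    defined for all [k < y]. *)
Fixpoint eval (A : cantor_space) (f : prog) (v : seq nat) (y : nat) : Prop :=
  match f with
  | Zero => y = 0
  | Succ => y = (nth 0 v 0).+1
  | Proj i => y = nth 0 v i
  | Query => y = A (nth 0 v 0)
  | Comp h gs => exists w : seq nat,
      (fix eval_all (gs : seq prog) (w : seq nat) : Prop :=
         match gs, w with
         | [::], [::] => True
         | g :: gs', z :: w' => eval A g v z /\ eval_all gs' w'
         | _, _ => False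
         end) gs w
      /\ eval A h w y
  | PrimRec h g =>
      match v with
      | [::] => False
      | n :: u =>
          (fix rec (n y : nat) : Prop :=
             match n with
             | 0 => eval A h u y
             | k.+1 => exists z, rec k z /\ eval A g [:: k, z & u] y
             end) n y
      end
  | Mu h => eval A h (y :: v) 0 /\
            (forall k, k < y -> exists z, eval A h (k :: v) z.+1)
  end.

(** The bijection between strings and naturals listing the strings by length
    (least significant bit first). *)
Fixpoint code (s : string) : nat :=
  if s is b :: s' then (b + (code s').*2).+1 else 0.

(** Unrelativized computability is computability with the empty oracle. *)
Definition empty_oracle : cantor_space := fun _ => false.

Definition re (A : cantor_space) (W : set string) : Prop :=
  exists f : prog, forall s, W s <-> exists y, eval A f [:: code s] y.

Definition uniformly_re (A : cantor_space) (W : nat -> set string) : Prop :=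
  exists f : prog, forall n s,
    W n s <-> exists y, eval A f [:: n; code s] y.

(** * Strings and open classes *)

Definition restr (X : cantor_space) (m : nat) : string := mkseq X m.

Definition cylinder (s : string) : set cantor_space :=
  [set X | restr X (size s) = s].

Definition open_class (W : set string) : set cantor_space :=
  \bigcup_(s in W) cylinder s.

Definition prefix_free (W : set string) : Prop :=
  forall s t, W s -> W t -> prefix s t -> s = t.

Definition concat (W W' : set string) : set string :=
  [set u | exists s t, [/\ W s, W' t & u = s ++ t]].

Fixpoint concat_pow (W : set string) (n : nat) : set string :=
  if n is k.+1 then concat (concat_pow W k) W else [set [::]].

Definition sigma01 (A : cantor_space) (U : set cantor_space) : Prop :=
  exists W : set string, re A W /\ U = open_class W.

(** A choice [gen] of a generating set for every [Sigma^0_1(A)] class, with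
    respect to which powers are formed. *)
Definition generator_choice (A : cantor_space)
    (gen : set cantor_space -> set string) : Prop :=
  forall U, sigma01 A U ->
    [/\ prefix_free (gen U), re A (gen U) & U = open_class (gen U)].

(** [Q^n], the complement of [(~` Q)^n]; meaningful for [n >= 1]. *)
Definition closed_pow (gen : set cantor_space -> set string)
    (Q : set cantor_space) (n : nat) : set cantor_space :=
  ~` open_class (concat_pow (gen (~` Q)) n).

(** * Prefix-free complexity *)

Definition runs (M : prog) (A : cantor_space) (p s : string) : Prop :=
  eval A M [:: code p] (code s).

Definition prefix_free_machine (M : prog) : Prop :=
  forall A, prefix_free [set p | exists s, runs M A p s].

(** Simulation up to an additive constant, uniformly in the oracle; machines
    that simulate [M] by prepending a fixed string to its programs qualify. *)
Definition universal_machine (U : prog) : Prop :=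
  prefix_free_machine U /\
  forall M, prefix_free_machine M ->
    exists c, forall A p s, runs M A p s ->
      exists q, runs U A q s /\ size q <= size p + c.

(** [is_K U A s k]: the complexity [K^A(s)] with respect to [U] is [k]. *)
Definition is_K (U : prog) (A : cantor_space) (s : string) (k : nat) : Prop :=
  (exists p, runs U A p s /\ size p = k) /\
  (forall p, runs U A p s -> k <= size p).

(** [K^A(X|m) <= m - n] is written without (truncated) subtraction. *)
Definition S_class (U : prog) (A : cantor_space) (n : nat) :
    set cantor_space :=
  [set X | exists m k, is_K U A (restr X m) k /\ k + n <= m].

(** * The uniform measure, tests and randomness *)

(** Cantor space with the sigma-algebra generated by the cylinders. *)
Notation cantorM := (g_sigma_algebraType (range cylinder)).

Local Open Scope ring_scope.
Local Open Scope ereal_scope.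

Section measure.
Context {R : realType}.
Variable mu : probability cantorM R.

(** This determines [mu]. *)
Definition uniform_measure : Prop :=
  forall s : string, mu (cylinder s) = (2^-1 ^+ size s)%:E.

Definition sigma_mu1 (A : cantor_space) (U : set cantor_space) : Prop :=
  sigma01 A U /\ mu U < 1.

Definition pi_mu1 (A : cantor_space) (Q : set cantor_space) : Prop :=
  sigma_mu1 A (~` Q).

Definition has_pi_mu1_subclass (C : set cantor_space) : Prop :=
  exists P, pi_mu1 empty_oracle P /\ P `<=` C.

Definition ML_test (A : cantor_space) (V : nat -> set cantor_space) : Prop :=
  (exists W : nat -> set string,
     uniformly_re A W /\ forall n, V n = open_class (W n)) /\
  (forall n, mu (V n) <= (2^-1 ^+ n)%:E).

Definition random (A : cantor_space) : set cantor_space :=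
  [set X | forall V, ML_test A V -> ~ (\bigcap_n V n) X].

End measure.

(* Main.v *)
Require Import Defs.
From mathcomp Require Import all_boot all_order all_algebra.
From mathcomp Require Import all_classical all_reals all_analysis.
From mathcomp Require Import ring lra zify.

(* The implications form a cycle.

   (1) => (2): if (2) fails for [Q], then every [S^A_n] is dense in [Q], so Baire category
   gives a point of [Q] in all of them; it is 1-random but not [A]-random, because the
   [S^A_n] form a test by Kraft's inequality.
   (2) => (3): apply (2) to the complement [Q] of the unrelativized [S_1]. A nonempty
   Pi^0_1 class of 1-random reals is not null, so [Q] intersected with [[sigma]] works.
   (3) => (4): a Shannon-Fano code compresses the strings generating a test, so that each
   [S^A_n] contains a member of any given test.
   (4) => (5): [mu (U^k) <= (mu U)^k], hence suitable powers of the complement of [Q]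
   form a test.
   (5) => (6): if [G] covers [U^(n+1)], then either some [G | sigma] with [sigma] in [U^n]
   has measure below 1 and covers [U], or [U^n] is covered by the class of strings in
   which [G] has density above [1 - 2^-k], again of measure below 1 for large [k].
   (6) => (7): the complement of [S^A_1] consists of [A]-random reals.
   (8) => (1): by Kucera's argument each 1-random real has a tail in the given subclass,
   and [A]-randomness only depends on tails. *)

Set Implicit Arguments.
Unset Strict Implicit.
Unset Printing Implicit Defensive.

Import Order.TTheory GRing.Theory Num.Theory.

Local Open Scope classical_set_scope.

Local Notation eval := Defs.eval.
Local Notation code := Defs.code.

(** Effectivity is carried by total functionals with one program for all oracles ([computable],
    [decidable_family]). This uniformity is forced by [universal_machine]: only a machine that is
    prefix-free for every oracle gets simulated, so the code behind (3) => (4) must behave well even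
    for oracles where the encoded sets have large measure. Laying the requested intervals side by
    side achieves this: they are disjoint whatever their total length, and the bound on the total
    only serves to show that for the oracle [A] every request obtains a description. Saving [m] bits
    is granted to members of the test class with index [2 * m], since the weights
    [2 ^ m * 2 ^ - (2 * m)] sum to at most 1.

    In (5) => (6) the generating set is enumerable only in [A], whereas the covering class must be
    enumerable without oracle. The case distinction is classical, and the new class inherits from it
    only a string [sigma] or a number [k]. *)

(** * Closure properties of total computable functionals *)

Definition eval_all (A : cantor_space) (v : seq nat) :=
  fix eval_all (gs : seq prog) (w : seq nat) : Prop :=
    match gs, w with
    | [::], [::] => True
    | g :: gs', z :: w' => eval A g v z /\ eval_all gs' w'
    | _, _ => False
    end.

(** [eval_all] is a named copy of the anonymous fixpoint inside [eval], so the two sides are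
    convertible. *)
Lemma eval_Comp A h gs v y :
  eval A (Comp h gs) v y <-> exists w, eval_all A v gs w /\ eval A h w y.
Proof. by []. Qed.

Definition computable n (F : cantor_space -> seq nat -> nat) : Prop :=
  exists f, forall A v, size v = n -> forall y, eval A f v y <-> y = F A v.

Fixpoint all_computable n (Fs : seq (cantor_space -> seq nat -> nat)) : Prop :=
  if Fs is F :: Fs' then computable n F /\ all_computable n Fs' else True.

Lemma computable_ext n F G :
  (forall A v, size v = n -> F A v = G A v) -> computable n F -> computable n G.
Proof. by move=> FG [f fF]; exists f => A v sv y; rewrite -FG //; apply: fF. Qed.

Lemma computable_nth n i : computable n (fun _ v => nth 0 v i).
Proof. by exists (Proj i). Qed.

Lemma all_computableP n Fs : all_computable n Fs ->
  exists gs, size gs = size Fs /\ forall A v, size v = n -> forall w,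
    eval_all A v gs w <-> w = [seq F A v | F <- Fs].
Proof.
elim: Fs => [_|F Fs IH /= [[f fF] /IH [gs [sgs gsFs]]]].
  by exists [::]; split => // A v _ [|z w].
exists (f :: gs); split=> [/=|A v sv [|z w] //=]; first by rewrite sgs.
split=> [[/fF -> // /gsFs -> //]|[-> ->]]; split; first exact/fF.
exact/gsFs.
Qed.

Lemma computable_subst n m G Fs : computable m G -> size Fs = m ->
  all_computable n Fs -> computable n (fun A v => G A [seq F A v | F <- Fs]).
Proof.
move=> [g gG] sFs /all_computableP[gs [sgs gsFs]]; exists (Comp g gs) => A v sv y.
rewrite eval_Comp; split.
  by move=> [w [/gsFs -> //]] /gG; rewrite size_map; apply.
by move=> ->; exists [seq F A v | F <- Fs]; split; [exact/gsFs|apply/gG; rewrite ?size_map].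
Qed.

Lemma all_computable_nth n k m :
  all_computable n [seq (fun _ v => nth 0 v i) | i <- iota k m].
Proof. by elim: m k => [|m IH] k //=; split; [exact: computable_nth|]. Qed.

Lemma map_nth_drop k m v : size v = k + m -> [seq nth 0 v i | i <- iota k m] = drop k v.
Proof.
elim: m k => [|m IH] k sv /=; first by rewrite drop_oversize // sv addn0.
by rewrite IH ?sv ?addnS // -drop_nth // sv addnS ltnS leq_addr.
Qed.

Lemma iter_behead k (v : seq nat) : iter k behead v = drop k v.
Proof. by elim: k v => [v|k IH v]; rewrite ?drop0 // iterSr IH -drop1 drop_drop addn1. Qed.

Lemma all_computable_cat n Fs Gs : all_computable n Fs -> all_computable n Gs ->
  all_computable n (Fs ++ Gs).
Proof. by elim: Fs => //= F Fs IH [cF cFs] cGs; split => //; exact: IH. Qed.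

(** Change of environment: the [k] innermost variables give way to the values of [Fs], and the [n]
    parameters stay. The form [iter k behead] reduces to the nested [behead] that bounded
    quantifiers and recursion produce. *)
Lemma computable_splice n k m F Fs : computable m F -> size Fs + n = m ->
  all_computable (k + n) Fs ->
  computable (k + n) (fun A v => F A ([seq G A v | G <- Fs] ++ iter k behead v)).
Proof.
move=> cF sm cFs; have := computable_subst cF
  (Fs := Fs ++ [seq (fun _ v => nth 0 v i) | i <- iota k n]) (n := k + n).
rewrite size_cat size_map size_iota => /(_ sm (all_computable_cat cFs (all_computable_nth _ _ _))).
by apply: computable_ext => A v sv; rewrite map_cat -map_comp map_nth_drop // iter_behead.
Qed.

Lemma computable0 n : computable n (fun _ _ => 0).
Proof. by exists Zero. Qed.

Lemma computable_op1 n (op : nat -> nat) F :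
  computable 1 (fun _ w => op (nth 0 w 0)) -> computable n F ->
  computable n (fun A v => op (F A v)).
Proof. by move=> cG cF; exact: (computable_subst (Fs := [:: F]) cG). Qed.

Lemma computable_op2 n (op : nat -> nat -> nat) F G :
  computable 2 (fun _ w => op (nth 0 w 0) (nth 0 w 1)) ->
  computable n F -> computable n G -> computable n (fun A v => op (F A v) (G A v)).
Proof. by move=> cH cF cG; exact: (computable_subst (Fs := [:: F; G]) cH). Qed.

Lemma computableS n F : computable n F -> computable n (fun A v => (F A v).+1).
Proof. by apply: (@computable_op1 n succn); exists Succ. Qed.

Lemma computable_cst n c : computable n (fun _ _ => c).
Proof. by elim: c => [|c IH]; [exact: computable0|exact: computableS]. Qed.

Lemma computable_query n F : computable n F -> computable n (fun A v => A (F A v) : nat).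
Proof.
have cQ : computable 1 (fun A w => A (nth 0 w 0) : nat) by exists Query.
by move=> cF; exact: (computable_subst (Fs := [:: F]) cQ).
Qed.

Lemma computable_rec n N B St : computable n N -> computable n B ->
  computable n.+2 (fun A w => St A (behead (behead w)) (nth 0 w 0) (nth 0 w 1)) ->
  computable n (fun A v => nat_rect (fun _ => nat) (B A v) (fun k z => St A v k z) (N A v)).
Proof.
move=> cN [h hB] [g gSt].
pose R A (w : seq nat) := nat_rect (fun _ => nat) (B A (behead w))
  (fun k z => St A (behead w) k z) (nth 0 w 0).
have cR : computable n.+1 R.
  exists (PrimRec h g) => A [//|m u] [su] y; rewrite /R /=.
  elim: m y => [|m IH] y /=; first exact: hB.
  split=> [[z [/IH -> ]]|->]; first by move=> /gSt -> //=; rewrite su.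
  by eexists; split; [exact/IH|apply/gSt => //=; rewrite su].
have := computable_subst cR
  (Fs := N :: [seq (fun _ v => nth 0 v i) | i <- iota 0 n]).
rewrite /= size_map size_iota => /(_ n erefl (conj cN (all_computable_nth _ _ _))).
apply: computable_ext => A v sv.
by rewrite /R /= -map_comp map_nth_drop // drop0.
Qed.

Lemma computable_beheads n k i : computable n (fun _ v => nth 0 (iter k behead v) i).
Proof.
apply: computable_ext (computable_nth n (k + i)) => A v _ /=; elim: k i => [//|k IH] i.
by rewrite addSnnS IH /= nth_behead.
Qed.

Lemma computable_nth1 n i : computable n (fun _ v => nth 0 (behead v) i).
Proof. exact: (@computable_beheads n 1). Qed.
Lemma computable_nth2 n i : computable n (fun _ v => nth 0 (behead (behead v)) i).
Proof. exact: (@computable_beheads n 2). Qed.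
Lemma computable_nth3 n i : computable n (fun _ v => nth 0 (behead (behead (behead v))) i).
Proof. exact: (@computable_beheads n 3). Qed.
Lemma computable_nth4 n i :
  computable n (fun _ v => nth 0 (behead (behead (behead (behead v)))) i).
Proof. exact: (@computable_beheads n 4). Qed.

Ltac comp_var := first [ exact: computable_nth | exact: computable_nth1
  | exact: computable_nth2 | exact: computable_nth3 | exact: computable_nth4
  | exact: computable_cst ].

Lemma computable_add n F G : computable n F -> computable n G ->
  computable n (fun A v => F A v + G A v).
Proof.
apply: computable_op2; apply: computable_ext (computable_rec (St := fun _ _ _ z => z.+1)
  (computable_nth 2 0) (computable_nth 2 1) _) => [A v _|].
  by elim: (nth 0 v 0) => //= k ->.
by apply: computableS; comp_var.
Qed.

Lemma computable_pred n F : computable n F -> computable n (fun A v => (F A v).-1).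
Proof.
apply: computable_op1; apply: computable_ext (computable_rec (St := fun _ _ k _ => k)
  (computable_nth 1 0) (computable0 1) _) => [A v _|]; last by comp_var.
by case: (nth 0 v 0).
Qed.

Lemma computable_sub n F G : computable n F -> computable n G ->
  computable n (fun A v => F A v - G A v).
Proof.
apply: computable_op2; apply: computable_ext (computable_rec (St := fun _ _ _ z => z.-1)
  (computable_nth 2 1) (computable_nth 2 0) _) => [A v _|].
  by elim: (nth 0 v 1) => /= [|k ->]; rewrite ?subn0 ?subnS.
by apply: computable_pred; comp_var.
Qed.

Lemma computable_mul n F G : computable n F -> computable n G ->
  computable n (fun A v => F A v * G A v).
Proof.
apply: computable_op2; apply: computable_ext (computable_rec
  (St := fun _ v _ z => nth 0 v 1 + z)
  (computable_nth 2 0) (computable0 2) _) => [A v _|].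
  by elim: (nth 0 v 0) => //= k ->; rewrite mulSn.
by apply: computable_add; comp_var.
Qed.

Lemma computable_exp n F G : computable n F -> computable n G ->
  computable n (fun A v => F A v ^ G A v).
Proof.
apply: computable_op2; apply: computable_ext (computable_rec
  (St := fun _ v _ z => nth 0 v 0 * z)
  (computable_nth 2 1) (computable_cst 2 1) _) => [A v _|].
  by elim: (nth 0 v 1) => //= k ->; rewrite expnS.
by apply: computable_mul; comp_var.
Qed.

Lemma computable_eq0 n F : computable n F -> computable n (fun A v => F A v == 0 : nat).
Proof.
apply: (computable_op1 (op := fun x => x == 0 : nat)).
apply: computable_ext (computable_sub (computable_cst 1 1) (computable_nth 1 0)) => A v _.
by case: (nth 0 v 0).
Qed.

Lemma computable_leq n F G : computable n F -> computable n G ->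
  computable n (fun A v => F A v <= G A v : nat).
Proof. by move=> cF cG; exact: computable_eq0 (computable_sub cF cG). Qed.

Lemma computable_neg n (P : cantor_space -> seq nat -> bool) :
  computable n (fun A v => P A v : nat) -> computable n (fun A v => ~~ P A v : nat).
Proof. by move/computable_eq0; apply: computable_ext => A v _; case: (P A v). Qed.

Lemma computable_and n (P Q : cantor_space -> seq nat -> bool) :
  computable n (fun A v => P A v : nat) -> computable n (fun A v => Q A v : nat) ->
  computable n (fun A v => P A v && Q A v : nat).
Proof.
by move=> cP cQ; apply: computable_ext (computable_mul cP cQ) => A v _; rewrite mulnb.
Qed.

Lemma computable_or n (P Q : cantor_space -> seq nat -> bool) :
  computable n (fun A v => P A v : nat) -> computable n (fun A v => Q A v : nat) ->
  computable n (fun A v => P A v || Q A v : nat).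
Proof.
move=> /computable_neg cP /computable_neg cQ.
by apply: computable_ext (computable_neg (computable_and cP cQ)) => A v _; rewrite negb_and !negbK.
Qed.

Lemma computable_eq n F G : computable n F -> computable n G ->
  computable n (fun A v => F A v == G A v : nat).
Proof.
move=> cF cG; have := computable_and (computable_leq cF cG) (computable_leq cG cF).
by apply: computable_ext => A v _; rewrite -eqn_leq.
Qed.

Lemma computable_if n (P : cantor_space -> seq nat -> bool) F G :
  computable n (fun A v => P A v : nat) -> computable n F -> computable n G ->
  computable n (fun A v => if P A v then F A v else G A v).
Proof.
move=> cP cF cG.
have := computable_add (computable_mul cP cF) (computable_mul (computable_neg cP) cG).
by apply: computable_ext => A v _; case: (P A v); rewrite ?mul1n ?mul0n ?addn0.
Qed.

Lemma computable_has n N (P : cantor_space -> seq nat -> nat -> bool) :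
  computable n N -> computable n.+1 (fun A w => P A (behead w) (nth 0 w 0) : nat) ->
  computable n (fun A v => has (fun k => P A v k) (iota 0 (N A v)) : nat).
Proof.
move=> cN cP.
apply: computable_ext (computable_rec (N := N) (B := fun _ _ => 0)
  (St := fun A v k z => P A v k || (z != 0) : nat) cN (computable0 n) _) => [A v _|].
  elim: (N A v) => [//|k IH]; rewrite -[in RHS]addn1 iotaD has_cat add0n /= IH.
  by rewrite orbF orbC; case: has.
have cQ := computable_splice (n := n) (k := 2) (Fs := [:: fun _ w => nth 0 w 0]) cP erefl
  (conj (computable_nth _ _) I).
by apply: computable_or cQ _; apply: computable_neg; apply: computable_eq0; comp_var.
Qed.

Lemma computable_all n N (P : cantor_space -> seq nat -> nat -> bool) :
  computable n N -> computable n.+1 (fun A w => P A (behead w) (nth 0 w 0) : nat) ->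
  computable n (fun A v => all (fun k => P A v k) (iota 0 (N A v)) : nat).
Proof.
move=> cN /computable_neg /(computable_has (P := fun A v k => ~~ P A v k) cN) /computable_neg.
apply: computable_ext => A v _; rewrite -all_predC /=; congr nat_of_bool.
by apply: eq_all => k /=; rewrite negbK.
Qed.

Ltac comp_step := first [ comp_var | apply: computable_add | apply: computableS
  | apply: computable_pred | apply: computable_sub | apply: computable_mul
  | apply: computable_exp | apply: computable_neg | apply: computable_and
  | apply: computable_or | apply: computable_eq0 | apply: computable_eq | apply: computable_leq
  | apply: computable_if | apply: computable_has | apply: computable_all ].
Ltac comp_arith := repeat comp_step.

(** * Step-bounded evaluation *)

Section prog_induction.
Variable P : prog -> Prop.
Hypothesis P_Zero : P Zero.
Hypothesis P_Succ : P Succ.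
Hypothesis P_Proj : forall i, P (Proj i).
Hypothesis P_Query : P Query.
Hypothesis P_Comp : forall h gs,
  P h -> foldr (fun g Q => P g /\ Q) True gs -> P (Comp h gs).
Hypothesis P_PrimRec : forall h g, P h -> P g -> P (PrimRec h g).
Hypothesis P_Mu : forall h, P h -> P (Mu h).

(** [prog] is a nested inductive type; this scheme also supplies hypotheses for the programs listed
    in [Comp]. *)
Fixpoint prog_nested_ind (f : prog) : P f :=
  match f with
  | Zero => P_Zero
  | Succ => P_Succ
  | Proj i => P_Proj i
  | Query => P_Query
  | Comp h gs => P_Comp (prog_nested_ind h)
      ((fix all_ind gs : foldr (fun g Q => P g /\ Q) True gs :=
        match gs with
        | [::] => I
        | g :: gs' => conj (prog_nested_ind g) (all_ind gs')
        end) gs)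
  | PrimRec h g => P_PrimRec (prog_nested_ind h) (prog_nested_ind g)
  | Mu h => P_Mu (prog_nested_ind h)
  end.
End prog_induction.

(* State of the search performed by [Mu]: [0] is still searching, [1] is stuck on
   an undefined value, [y.+2] has found [y]. *)
Definition mu_step (val : nat -> nat) (k z : nat) : nat :=
  if z == 0 then (if val k == 0 then 1 else if val k == 1 then k.+2 else 0) else z.

(* [0] stands for "no output within [t] steps" and [y.+1] for the output [y]. *)
Fixpoint steval (A : cantor_space) (t : nat) (f : prog) (v : seq nat) : nat :=
  match f with
  | Zero => 1
  | Succ => (nth 0 v 0).+2
  | Proj i => (nth 0 v i).+1
  | Query => (A (nth 0 v 0)).+1
  | Comp h gs =>
      let ws := [seq steval A t g v | g <- gs] in
      if all (fun w => w != 0) ws then steval A t h [seq w.-1 | w <- ws] else 0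
  | PrimRec h g =>
      if v is n :: u then
        nat_rect (fun _ => nat) (steval A t h u)
          (fun k z => if z == 0 then 0 else steval A t g [:: k, z.-1 & u]) n
      else 0
  | Mu h => (nat_rect (fun _ => nat) 0 (mu_step (fun k => steval A t h (k :: v))) t).-1
  end.

(** A value 1 encodes the output 0 and a value above 1 a positive output. The predecessor merges the
    states of a search that is still running or stuck into [no output]. *)
Lemma mu_searchP (val : nat -> nat) t y :
  (nat_rect (fun _ => nat) 0 (mu_step val) t).-1 = y.+1 <->
  [/\ y < t, val y = 1 & forall k, k < y -> 1 < val k].
Proof.
set s := nat_rect _ _ _.
(* Two invariants of the search: when it is still running, and when it has found [y]. *)
have s0 n : s n = 0 <-> forall k, k < n -> 1 < val k.
  elim: n => [//|n IH]; rewrite /= -/s; rewrite /mu_step; split.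
    case: eqP => [/IH H|//]; case: eqP => // v0; case: eqP => // v1 _ k.
    by rewrite ltnS leq_eqVlt => /predU1P[->|/H//]; case: (val n) v0 v1 => [|[]].
  move=> H; have -> : s n = 0 by apply/IH => k kn; apply: H; rewrite ltnS ltnW.
  by rewrite eqxx; case: (val n) (H n (ltnSn n)) => [|[]].
have s2 n : s n = y.+2 <-> [/\ y < n, val y = 1 & forall k, k < y -> 1 < val k].
  elim: n => [|n IH]; first by split => // -[].
  rewrite /= -/s /mu_step; case: eqP => [sn0|sn].
    have sn := (s0 n).1 sn0; split.
      by case: eqP => // _; case: eqP => // vn [<-].
    move=> [yn vy H]; have -> : y = n.
      apply/eqP; move: yn; rewrite ltnS leq_eqVlt => /predU1P[->//|/sn]; by rewrite vy.
    move: vy; rewrite ltnS leq_eqVlt in yn; case/predU1P: yn => [->->|/sn]//.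
    by move=> + vy; rewrite vy.
  rewrite IH; split=> -[yn vy H]; split => //; first exact: ltnW.
  move: yn; rewrite ltnS leq_eqVlt => /predU1P[yn|//]; case: sn; apply/s0 => k.
  by rewrite -yn; exact: H.
rewrite -s2. by case: (s t) => [|[|?]]; split=> //= [->|[->]].
Qed.

Lemma steval_sound A t f v y : steval A t f v = y.+1 -> eval A f v y.
Proof.
elim/prog_nested_ind: f v y => [|||| h gs IHh IHgs|h g IHh IHg|h IHh] v y /=.
- by case.
- by case.
- by move=> i [].
- by case.
- case: ifP => // nz /IHh Hh; eexists; split; last exact: Hh.
  rewrite -/(eval_all A v) -map_comp.
  elim: gs IHgs nz {Hh} => //= g gs IH [Hg /IH{}IH] /andP[gz /IH]; split => //.
  by apply: Hg; rewrite prednK // lt0n.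
- case: v => [//|n u]; elim: n y => [|n IH] y /=; first exact: IHh.
  case: ifP => // nz /IHg Hg; eexists; split; last exact: Hg.
  by apply: IH; rewrite prednK // lt0n nz.
- move=> /mu_searchP[_ /IHh Hy H]; split => // k /H.
  by case E: (steval A t h (k :: v)) => [|[|z]] // _; exists z; apply: IHh.
Qed.

Lemma eventually_forall_lt (P : nat -> nat -> Prop) n :
  (forall k, k < n -> exists t0, forall t, t0 <= t -> P k t) ->
  exists t0, forall t, t0 <= t -> forall k, k < n -> P k t.
Proof.
elim: n => [|n IH] H; first by exists 0.
have [t0 H0] := IH (fun k kn => H k (ltnW kn)).
have [t1 H1] := H n (ltnSn n).
exists (maxn t0 t1) => t; rewrite geq_max => /andP[tt0 tt1] k.
by rewrite ltnS leq_eqVlt => /predU1P[->|/(H0 _ tt0)//]; exact: H1.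
Qed.

(** Stated as stability from some stage on, so that finitely many subcomputations meet at the
    maximum of their stages. *)
Lemma steval_complete A f v y : eval A f v y ->
  exists t0, forall t, t0 <= t -> steval A t f v = y.+1.
Proof.
elim/prog_nested_ind: f v y => [|||| h gs IHh IHgs|h g IHh IHg|h IHh] v y.
- by move=> /= ->; exists 0.
- by move=> /= ->; exists 0.
- by move=> i /= ->; exists 0.
- by move=> /= ->; exists 0.
- rewrite eval_Comp => -[w [Hw /IHh[t0 H0]]].
  have [t1 H1] : exists t1, forall t, t1 <= t ->
      [seq steval A t g v | g <- gs] = [seq z.+1 | z <- w].
    elim: gs w IHgs Hw {H0} => [|g gs IH] [|z w] //=; first by exists 0.
    move=> [Hg /IH{}IH] [/Hg[t2 H2] /IH[t3 H3]].
    exists (maxn t2 t3) => t; rewrite geq_max => /andP[tt2 tt3].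
    by rewrite H2 // H3.
  exists (maxn t0 t1) => t; rewrite geq_max => /andP[tt0 tt1] /=.
  rewrite H1 // all_map (eq_all (a2 := predT)) // all_predT -map_comp.
  by rewrite (eq_map (g := id)) // map_id H0.
- case: v => [//|n u] /=; elim: n y => [|n IH] y /=; first exact: IHh.
  move=> [z [/IH[t0 H0] /IHg[t1 H1]]].
  exists (maxn t0 t1) => t; rewrite geq_max => /andP[tt0 tt1].
  by rewrite H0 //= H1.
- move=> /= [/IHh[t0 H0] H].
  have [t1 H1] := eventually_forall_lt
    (P := fun k t => 1 < steval A t h (k :: v)) (fun k ky =>
    let: ex_intro z Hz := H k ky in let: ex_intro t1 H1 := IHh _ _ Hz in
    ex_intro _ t1 (fun t tt1 => etrans (congr1 (leq 2) (H1 t tt1)) erefl)).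
  exists (maxn y.+1 (maxn t0 t1)) => t.
  rewrite !geq_max => /and3P[yt tt0 tt1]; apply/mu_searchP; split => //.
    exact: H0.
  exact: H1.
Qed.

Lemma eval_inj A f v y y' : eval A f v y -> eval A f v y' -> y = y'.
Proof.
move=> /steval_complete[t0 H0] /steval_complete[t1 H1].
have := H0 _ (leq_maxl t0 t1); rewrite H1 ?leq_maxr //.
by case.
Qed.

(** The program is fixed and the stage is an argument, so induction on [f] gives one evaluator for
    each [f]. Every enumeration below rests on it. *)
Lemma steval_computable f n :
  computable n.+1 (fun A v => steval A (nth 0 v 0) f (behead v)).
Proof.
elim/prog_nested_ind: f n => [|||| h gs IHh IHgs|h g IHh IHg|h IHh] n /=.
- comp_arith.
- by apply: computableS; apply: computableS; comp_arith.
- by move=> i; apply: computableS; comp_arith.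
- by apply: computableS; apply: computable_query; comp_arith.
- pose ws A v := [seq steval A (nth 0 v 0) g (behead v) | g <- gs].
  have call : computable n.+1 (fun A v => all (fun w => w != 0) (ws A v) : nat).
    rewrite /ws; elim: gs IHgs {ws} => [_|g gs IH /= [Hg Hgs]] /=; first comp_arith.
    apply: computable_and; last exact: IH.
    by apply: computable_neg; apply: computable_eq0; exact: Hg.
  apply: computable_if => //; last by comp_arith.
  pose Fs := (fun _ v => nth 0 v 0) ::
    [seq (fun A v => (steval A (nth 0 v 0) g (behead v)).-1) | g <- gs].
  have := computable_subst (IHh (size gs)) (n := n.+1) (Fs := Fs).
  rewrite /= size_map => /(_ erefl) H.
  apply: computable_ext (H _); last first.
    split; first by comp_arith.
    elim: gs IHgs {ws call Fs H} => [//|g gs IH /= [Hg Hgs]]; split.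
      by apply: computable_pred; exact: Hg.
    exact: IH.
  by move=> A v _; rewrite /= -!map_comp.
- case: n => [|n].
    by apply: computable_ext (computable0 _) => A [|? []].
  apply: (@computable_ext _ (fun A v => nat_rect (fun _ => nat)
    (steval A (nth 0 v 0) h (behead (behead v)))
    (fun k z => if z == 0 then 0 else
      steval A (nth 0 v 0) g [:: k, z.-1 & behead (behead v)]) (nth 0 v 1))).
    by move=> A [|t [|m u]].
  apply: computable_rec; first by comp_arith.
    exact: (computable_splice (n := n) (k := 2) (Fs := [:: fun _ w => nth 0 w 0])
      (IHh n) erefl (conj (computable_nth _ _) I)).
  apply: (computable_if (P := fun _ w => nth 0 w 1 == 0)); [by comp_arith..|].
  apply: (computable_splice (n := n) (k := 4) (IHg n.+2) (Fs :=
    [:: (fun _ w => nth 0 (behead (behead w)) 0); (fun _ w => nth 0 w 0);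
        (fun _ w => (nth 0 w 1).-1)])) => //.
  by do ?split; comp_arith.
- apply: computable_pred; apply: computable_rec; [by comp_arith..|].
  rewrite /mu_step.
  have cval : computable n.+3 (fun A w =>
      steval A (nth 0 (behead (behead w)) 0) h (nth 0 w 0 :: behead (behead (behead w)))).
    apply: (computable_splice (n := n) (k := 3) (IHh n.+1) (Fs :=
      [:: (fun _ w => nth 0 (behead (behead w)) 0); (fun _ w => nth 0 w 0)])) => //.
    by do ?split; comp_arith.
  apply: (computable_if (P := fun _ w => nth 0 w 1 == 0)); [by comp_arith| |by comp_arith].
  apply: (computable_if (P := fun A w => steval A (nth 0 (behead (behead w)) 0) h
      (nth 0 w 0 :: behead (behead (behead w))) == 0)).
  + exact: computable_eq0.
  + by comp_arith.
  apply: (computable_if (P := fun A w => steval A (nth 0 (behead (behead w)) 0) h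
      (nth 0 w 0 :: behead (behead (behead w))) == 1)).
  + by apply: computable_eq => //; comp_arith.
  + by do 2 apply: computableS; comp_arith.
  + by comp_arith.
Qed.

(** Used both to semi-decide an existential statement and, for the compressing machine, to output
    the witness itself. *)
Lemma computable_search n (P : cantor_space -> seq nat -> bool) :
  computable n.+1 (fun A v => P A v : nat) ->
  exists f, forall A v, size v = n -> forall y,
    eval A f v y <-> P A (y :: v) /\ forall k, k < y -> ~~ P A (k :: v).
Proof.
move=> /computable_eq0[h hP]; exists (Mu h) => A v sv y /=.
have hE k z : eval A h (k :: v) z <-> z = ~~ P A (k :: v).
  by rewrite hP /= ?sv // eqb0.
split=> [[/hE Py H]|[Py H]].
  split; first by move: Py; case: (P A (y :: v)).
  by move=> k /H[z /hE]; case: (P A (k :: v)).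
split; first by apply/hE; rewrite Py.
by move=> k /H Pk; exists 0; apply/hE; rewrite Pk.
Qed.

Lemma computable_enum n (P : cantor_space -> seq nat -> bool) :
  computable n.+1 (fun A v => P A v : nat) ->
  exists f, forall A v, size v = n ->
    (exists y, eval A f v y) <-> exists t, P A (t :: v).
Proof.
move=> /computable_search[f fP]; exists f => A v sv; split.
  by move=> [y /fP[] // Py _]; exists y.
move=> exP; case: (ex_minnP exP) => y Py miny; exists y; apply/fP => //; split=> // k ky.
by apply: contraTN ky => /miny; rewrite -leqNgt.
Qed.

Lemma re_enum (P : cantor_space -> seq nat -> bool) A W :
  computable 2 (fun A v => P A v : nat) ->
  (forall s, W s <-> exists t, P A [:: t; code s]) -> re A W.
Proof.
by move=> /computable_enum[f fP] WP; exists f => s; rewrite WP fP.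
Qed.

Lemma uniformly_re_enum (P : cantor_space -> seq nat -> bool) A W :
  computable 3 (fun A v => P A v : nat) ->
  (forall n s, W n s <-> exists t, P A [:: t; n; code s]) -> uniformly_re A W.
Proof.
by move=> /computable_enum[f fP] WP; exists f => n s; rewrite WP fP.
Qed.

Lemma re_uniformly_re A W : re A W -> uniformly_re A (fun _ => W).
Proof.
move=> [f fW]; exists (Comp f [:: Proj 1]) => n s; rewrite fW; split=> -[y].
  by move=> Hy; exists y; rewrite eval_Comp; exists [:: code s].
by rewrite eval_Comp => -[[|? [|??]] [//= [->]]] // _ ?; exists y.
Qed.

Lemma uniformly_re_re A W n : uniformly_re A W -> re A (W n).
Proof.
have [g gn] := computable_cst 1 n.
move=> [f fW]; exists (Comp f [:: g; Proj 0]) => s; rewrite fW; split=> -[y].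
  by move=> Hy; exists y; rewrite eval_Comp; exists [:: n; code s]; split=> //=; rewrite gn.
rewrite eval_Comp => -[[|? [|? [|??]]] [//= [+ []]]] //=.
by rewrite gn // => -> [-> _] Hy; exists y.
Qed.

(** * Strings and their codes *)

(** Inverse of [code], which is bijective binary notation. Halving is not structurally recursive,
    hence the fuel, for which the number itself suffices. *)
Fixpoint decode_fuel (k n : nat) : string :=
  if (k, n) is (k'.+1, m.+1) then odd m :: decode_fuel k' m./2 else [::].

Definition decode (n : nat) : string := decode_fuel n n.

Lemma decodeK : cancel decode code.
Proof.
suff H k n : n <= k -> code (decode_fuel k n) = n by move=> n; exact: H.
elim: k n => [|k IH] [|n] //= nk.
rewrite IH ?odd_double_half //.
by rewrite leq_half_double -addnn -addSn (leq_trans (ltnW nk)) // leq_addr.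
Qed.

Lemma code_inj : injective code.
Proof.
elim=> [|a s IH] [|b t] //= [] E.
have ab : a = b by move: (congr1 odd E); rewrite !oddD !odd_double !addbF !oddb.
congr cons => //; apply: IH; move: E; rewrite ab => /addnI.
exact: double_inj.
Qed.

Lemma codeK : cancel code decode.
Proof. by move=> s; apply: code_inj; rewrite decodeK. Qed.

(** Turns operations on strings into arithmetic on codes; [take] is obtained from [drop] by solving
    this equation for [code s]. *)
Lemma code_cat s t : code (s ++ t) = code s + 2 ^ size s * code t.
Proof.
elim: s => [|b s IH] /=; first by rewrite mul1n.
by rewrite IH doubleD expnS -!mul2n !mulnA addSn addnA.
Qed.

Lemma code_drop1 s : code (behead s) = (code s).-1./2.
Proof. by case: s => [//|b s] /=; rewrite half_bit_double. Qed.

Lemma code_drop k s : code (drop k s) = iter k (fun c => c.-1./2) (code s).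
Proof.
elim: k => [|k IH]; first by rewrite drop0.
by rewrite iterS -IH -code_drop1 -drop1 drop_drop add1n.
Qed.

Lemma code_take k s : code (take k s) = code s - 2 ^ k * code (drop k s).
Proof.
rewrite -{2}(cat_take_drop k s) code_cat size_take.
case: ltnP => [_|sk]; first by rewrite addnK.
by rewrite drop_oversize // !muln0 addn0 subn0.
Qed.

Lemma size_le_code s : size s <= code s.
Proof. by elim: s => [//|b s IH] /=; rewrite ltnS -addnn addnA (leq_trans IH) // leq_addl. Qed.

(** Counts the [k] for which something remains after dropping [k] letters, a bounded sum that is
    computable from the code. *)
Lemma size_has_drop s : size s = \sum_(0 <= k < code s) (code (drop k s) != 0).
Proof.
rewrite (big_cat_nat (n := size s)) ?size_le_code //= [X in _ + X]big_nat_cond.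
rewrite [X in _ + X]big1 ?addn0; last first.
  by move=> k /andP[/andP[sk _] _]; rewrite drop_oversize.
rewrite big_nat_cond (eq_bigr (fun=> 1)).
  by rewrite -big_nat_cond big_const_nat iter_addn_0 mul1n subn0.
move=> k /andP[/andP[_ ks] _].
by case: (drop k s) (size_drop k s) => [/eqP|//]; rewrite eq_sym subn_eq0 leqNgt ks.
Qed.

Definition scomputable n (F : cantor_space -> seq nat -> string) : Prop :=
  computable n (fun A v => code (F A v)).

Lemma computable_half n F : computable n F -> computable n (fun A v => (F A v)./2).
Proof.
apply: computable_op1.
apply: computable_ext (computable_rec (N := fun _ v => nth 0 v 0) (B := fun _ _ => 0)
  (* The accumulator is [k./2], which increases from [k] to [k.+1] exactly when [k] is odd. *)
  (St := fun _ _ k z => if z.*2.+1 == k then z.+1 else z) _ _ _) => [A v _|||].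
- elim: (nth 0 v 0) => [//|k IH] /=; rewrite IH uphalf_half.
  rewrite -[in X in _ == X](odd_double_half k) -add1n eqn_add2r.
  by case: (odd k).
- by comp_arith.
- by comp_arith.
- apply: (computable_if (P := fun _ w => ((nth 0 w 1).*2.+1 == nth 0 w 0))); [|by comp_arith..].
  apply: computable_eq; last by comp_arith.
  apply: computableS.
  apply: computable_ext (computable_mul (computable_cst _ 2) (computable_nth _ 1)).
  by move=> A v _; rewrite mul2n.
Qed.

Lemma computable_iter n (op : nat -> nat) N F :
  (forall m G, computable m G -> computable m (fun A v => op (G A v))) ->
  computable n N -> computable n F -> computable n (fun A v => iter (N A v) op (F A v)).
Proof.
move=> cop; apply: (computable_op2 (op := fun k x => iter k op x)).
apply: computable_ext (computable_rec (N := fun _ v => nth 0 v 0) (B := fun _ v => nth 0 v 1)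
  (St := fun _ _ k z => op z) _ _ _) => [A v _|||]; [|by comp_arith..|].
  by elim: (nth 0 v 0) => //= k ->.
by apply: cop; comp_arith.
Qed.

Lemma scomputable_cst n s : scomputable n (fun _ _ => s).
Proof. exact: computable_cst. Qed.

Lemma scomputable_decode n F : computable n F -> scomputable n (fun A v => decode (F A v)).
Proof. by apply: computable_ext => A v _; rewrite decodeK. Qed.

Lemma scomputable_drop n K S : computable n K -> scomputable n S ->
  scomputable n (fun A v => drop (K A v) (S A v)).
Proof.
move=> cK cS.
apply: computable_ext (computable_iter (op := fun c => c.-1./2) _ cK cS) => [A v _|m G cG].
  by rewrite code_drop.
by apply: computable_half; apply: computable_pred.
Qed.

Lemma scomputable_take n K S : computable n K -> scomputable n S ->
  scomputable n (fun A v => take (K A v) (S A v)).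
Proof.
move=> cK cS; have cD := scomputable_drop cK cS.
have := computable_sub cS (computable_mul (computable_exp (computable_cst _ 2) cK) cD).
by apply: computable_ext => A v _; rewrite code_take.
Qed.

Lemma computable_size n S : scomputable n S -> computable n (fun A v => size (S A v)).
Proof.
move=> cS.
suff : computable n (fun A v => size (decode (code (S A v)))).
  by apply: computable_ext => A v _; rewrite codeK.
move: cS; apply: (computable_op1 (op := fun c => size (decode c))).
apply: computable_ext (computable_rec (N := fun _ v => nth 0 v 0) (B := fun _ _ => 0)
  (St := fun _ v k z => z + ~~ (code (drop k (decode (nth 0 v 0))) == 0)) _ _ _) => [A v _|||].
- rewrite size_has_drop decodeK; move: (decode _) => s.
  elim: (nth 0 v 0) => [|k IH] /=; first by rewrite big_nil.
  by rewrite big_nat_recr //= IH.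
- by comp_arith.
- by comp_arith.
- apply: computable_add; first by comp_arith.
  apply: computable_neg; apply: computable_eq0.
  by apply: scomputable_drop; [|apply: scomputable_decode]; comp_arith.
Qed.

Lemma scomputable_cat n S S' : scomputable n S -> scomputable n S' ->
  scomputable n (fun A v => S A v ++ S' A v).
Proof.
move=> cS cS'.
have cE := computable_exp (computable_cst n 2) (computable_size cS).
have := computable_add cS (computable_mul cE cS').
by apply: computable_ext => A v _; rewrite code_cat.
Qed.

Lemma computable_seq_eq n S S' : scomputable n S -> scomputable n S' ->
  computable n (fun A v => S A v == S' A v : nat).
Proof.
move=> cS cS'; apply: computable_ext (computable_eq cS cS') => A v _.
by rewrite (inj_eq code_inj).
Qed.

Ltac comp_step ::= first [ comp_var | apply: computable_add | apply: computableS
  | apply: computable_pred | apply: computable_sub | apply: computable_mul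
  | apply: computable_exp | apply: computable_neg | apply: computable_and
  | apply: computable_or | apply: computable_seq_eq | apply: computable_eq0
  | apply: computable_eq | apply: computable_leq
  | apply: computable_if | apply: computable_has | apply: computable_all
  | apply: computable_size | apply: scomputable_cst | apply: scomputable_decode
  | apply: scomputable_drop | apply: scomputable_take | apply: scomputable_cat ].

Definition decidable_family (D : cantor_space -> nat -> string -> bool) : Prop :=
  computable 2 (fun A v => D A (nth 0 v 0) (decode (nth 0 v 1)) : nat).

Lemma computable_family n D N S : decidable_family D ->
  computable n N -> scomputable n S -> computable n (fun A v => D A (N A v) (S A v) : nat).
Proof.
move=> cD cN cS.
apply: computable_ext (computable_subst cD (Fs := [:: N; (fun A v => code (S A v))]) erefl _).
  by move=> A v _ /=; rewrite codeK.
by do ?split.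
Qed.

(** Weakening past the previous value, which the step of a recursion sees as its second variable. *)
Lemma computable_skip n F : computable n.+1 (fun A w => F A (behead w) (nth 0 w 0)) ->
  computable n.+2 (fun A w => F A (behead (behead w)) (nth 0 w 0)).
Proof.
move=> cF; exact: (computable_splice (n := n) (k := 2) (Fs := [:: fun _ w => nth 0 w 0]) cF erefl
  (conj (computable_nth _ _) I)).
Qed.

Lemma computable_steval n f T M C :
  computable n T -> computable n M -> computable n C ->
  computable n (fun A v => steval A (T A v) f [:: M A v; C A v]).
Proof.
by move=> cT cM cC; exact: (computable_subst (steval_computable f 2) (Fs := [:: T; M; C])).
Qed.

Lemma computable_steval1 n f T C :
  computable n T -> computable n C ->
  computable n (fun A v => steval A (T A v) f [:: C A v]).
Proof.
by move=> cT cC; exact: (computable_subst (steval_computable f 1) (Fs := [:: T; C])).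
Qed.

(** * Open classes *)

Lemma size_restr X m : size (restr X m) = m.
Proof. exact: size_mkseq. Qed.

Lemma take_restr X k m : take k (restr X m) = restr X (minn k m).
Proof. by rewrite /restr /mkseq -map_take take_iota. Qed.

Lemma restr_take X k m : k <= m -> take k (restr X m) = restr X k.
Proof. by move=> km; rewrite take_restr (minn_idPl km). Qed.

Lemma open_classP W X : open_class W X <-> exists m, W (restr X m).
Proof.
split=> [[s Ws Xs]|[m Wm]]; first by exists (size s); rewrite (Xs : restr X (size s) = s).
by exists (restr X m); rewrite // /cylinder /= size_restr.
Qed.

Lemma cylinder_restr X m : cylinder (restr X m) X.
Proof. by rewrite /cylinder /= size_restr. Qed.

Lemma cylinder_prefix s t X : cylinder s X -> cylinder t X -> size s <= size t -> prefix s t.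
Proof.
rewrite /cylinder /= => <- <-.
by rewrite !size_restr prefixE size_restr => /restr_take ->.
Qed.

(** The prefix-minimal elements of [H]: they generate the same open class and remain decidable when
    [H] is. *)
Definition first_hit (H : string -> bool) (u : string) : bool :=
  H u && all (fun k => ~~ H (take k u)) (iota 0 (size u)).

Lemma first_hitP (H : string -> bool) u :
  reflect (H u /\ forall k, k < size u -> ~~ H (take k u)) (first_hit H u).
Proof.
apply: (iffP andP) => -[Hu H0]; split => //.
  by move=> k ku; apply: (allP H0); rewrite mem_iota.
by apply/allP => k; rewrite mem_iota => /H0.
Qed.

Lemma first_hit_prefix_free H : prefix_free (first_hit H).
Proof.
move=> s t /first_hitP[Hs _] /first_hitP[_ Ht]; rewrite prefixE => /eqP st.
case: (ltnP (size s) (size t)) => [/Ht|ts]; first by rewrite st Hs.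
by rewrite -st take_oversize.
Qed.

Lemma open_first_hit H : open_class (first_hit H) = open_class H.
Proof.
apply/seteqP; split=> X /open_classP[m].
  by move=> /first_hitP[Hm _]; apply/open_classP; exists m.
move=> Hm; have : exists m, H (restr X m) by exists m.
move=> /ex_minnP[k Hk mink]; apply/open_classP; exists k; apply/first_hitP.
split=> // j; rewrite size_restr => jk; rewrite restr_take ?(ltnW jk) //.
by apply: contraTN jk => /mink; rewrite -leqNgt.
Qed.

(** The first hypothesis has one more variable because [H] is also tested under the bounded
    quantifier of [first_hit]. *)
Lemma computable_first_hit n (H : cantor_space -> seq nat -> string -> bool) S :
  (forall S', scomputable n.+1 S' -> computable n.+1 (fun A v => H A (behead v) (S' A v) : nat)) ->
  computable n (fun A v => H A v (S A v) : nat) ->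
  scomputable n S -> computable n (fun A v => first_hit (H A v) (S A v) : nat).
Proof.
move=> cH cHS cS; apply: computable_and => //.
apply: (computable_all (N := fun A v => size (S A v))
  (P := fun A v k => ~~ H A v (take k (S A v)))).
  exact: computable_size.
apply: computable_neg; apply: cH; apply: scomputable_take; first by comp_arith.
exact: (computable_splice (n := n) (k := 1) (Fs := [::]) cS).
Qed.

(* Every uniformly c.e. open class is generated by decidable prefix-free sets: the
   shortest [u] such that some prefix of [u] is enumerated within [size u] steps. *)
Lemma uniformly_re_normal A W : uniformly_re A W ->
  exists D, [/\ decidable_family D, forall B m, prefix_free (D B m)
    & forall m, open_class (W m) = open_class (D A m)].
Proof.
move=> [f fW].
pose H B m u := has (fun k => has (fun t => steval B t f [:: m; code (take k u)] != 0)
  (iota 0 (size u).+1)) (iota 0 (size u).+1).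
have cH n M S : computable n.+1 M -> scomputable n.+1 S -> 
    computable n.+1 (fun B v => H B (M B v) (S B v) : nat).
  move=> cM cS.
  have cH2 : decidable_family H.
    rewrite /decidable_family /H.
    apply: computable_has; first by comp_arith.
    apply: computable_has; first by comp_arith.
    apply: computable_neg; apply: computable_eq0; apply: computable_steval; by comp_arith.
  exact: computable_family cH2 cM cS.
exists (fun B m => first_hit (H B m)); split.
- apply: (computable_first_hit (H := fun B v => H B (nth 0 v 0))).
  + by move=> S cS; apply: cH => //; comp_arith.
  + by apply: cH; comp_arith.
  + by comp_arith.
- by move=> B m; exact: first_hit_prefix_free.
- move=> m; rewrite open_first_hit; apply/seteqP; split=> X /open_classP[k].
    (* In [H] the length of the string bounds both the prefix and the number of steps, hence the
       maximum. *)
    move=> /fW[y /steval_complete[t Ht]]; apply/open_classP; exists (maxn k t).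
    apply/hasP; exists k; first by rewrite mem_iota size_restr ltnS leq_maxl.
    apply/hasP; exists (maxn k t); first by rewrite mem_iota size_restr ltnS leqnn.
    by rewrite restr_take ?leq_maxl // Ht // leq_maxr.
  move=> /hasP[j _ /hasP[t _ Ht]]; apply/open_classP; exists (minn j k).
  apply/fW; exists (steval A t f [:: m; code (restr X (minn j k))]).-1.
  apply: (@steval_sound _ t); rewrite prednK // lt0n.
  by rewrite -take_restr.
Qed.

(** * Sums of dyadic weights *)

(* [2 ^ T] times the sum of the weights [2 ^ - l k] of the [k < T] satisfying [b]. *)
Definition weight_sum (b : nat -> bool) (l : nat -> nat) (T : nat) : nat :=
  nat_rect (fun _ => nat) 0 (fun k z => 2 * z + (if b k then 2 ^ (k.+1 - l k) else 0)) T.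

Lemma computable_weight_sum n (b : cantor_space -> seq nat -> nat -> bool) l N :
  computable n.+1 (fun A w => b A (behead w) (nth 0 w 0) : nat) ->
  computable n.+1 (fun A w => l A (behead w) (nth 0 w 0)) ->
  computable n N ->
  computable n (fun A v => weight_sum (b A v) (l A v) (N A v)).
Proof.
move=> cb cl cN; apply: computable_rec => //; first by comp_arith.
apply: computable_add; first by comp_arith.
apply: (computable_if (P := fun A w => b A (behead (behead w)) (nth 0 w 0))).
- exact: (computable_skip (F := fun A v k => b A v k : nat)).
- apply: computable_exp; first by comp_arith.
  by apply: computable_sub; [comp_arith|exact: computable_skip].
- by comp_arith.
Qed.

(** * Measure *)

Definition prepend (s : string) (Y : cantor_space) : cantor_space :=
  fun n => if n < size s then nth false s n else Y (n - size s).

Lemma restr_prepend s Y m : restr (prepend s Y) (size s + m) = s ++ restr Y m.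
Proof.
apply: (@eq_from_nth _ false); first by rewrite size_cat !size_restr.
move=> i; rewrite size_restr => im; rewrite nth_mkseq // nth_cat /prepend.
by case: ltnP => // si; rewrite nth_mkseq // ltn_subLR.
Qed.

Lemma cylinder_prepend s Y : cylinder s (prepend s Y).
Proof. by rewrite /cylinder /= -[X in restr _ X]addn0 restr_prepend cats0. Qed.

Lemma cylinder_prependP s X : cylinder s X -> exists Y, X = prepend s Y.
Proof.
move=> sX; exists (fun n => X (size s + n)); apply/funext => n; rewrite /prepend.
case: ltnP => [ns|sn]; last by rewrite subnKC.
by rewrite -(sX : restr X (size s) = s) nth_mkseq // -[X in n < X](size_restr X).
Qed.

Definition has_prefix (D : string -> bool) (u : string) : bool :=
  has (fun k => D (take k u)) (iota 0 (size u).+1).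

Lemma has_prefixP (D : string -> bool) u : reflect (exists k, D (take k u)) (has_prefix D u).
Proof.
apply: (iffP hasP) => [[k _ Dk]|[k Dk]]; first by exists k.
exists (minn k (size u)); first by rewrite mem_iota ltnS geq_minr.
by rewrite take_min take_size.
Qed.

Lemma computable_has_prefix n D N S : decidable_family D ->
  computable n N -> scomputable n S ->
  computable n (fun A v => has_prefix (D A (N A v)) (S A v) : nat).
Proof.
move=> cD cN cS.
have cH : decidable_family (fun A m => has_prefix (D A m)).
  apply: computable_has; first by comp_arith.
  by apply: computable_family => //; comp_arith.
exact: computable_family cH cN cS.
Qed.

(** The element of [D] that catches the real may be shorter than [s], so [s ++ t] is only required
    to have a prefix in [D]. *)
Lemma open_prepend (D : string -> bool) s Y :
  open_class D (prepend s Y) <-> open_class (fun t => has_prefix D (s ++ t)) Y.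
Proof.
rewrite !open_classP; split=> -[m].
  move=> Dm; exists m; apply/has_prefixP; exists m.
  by rewrite -restr_prepend restr_take ?leq_addl.
move=> /has_prefixP[k]; rewrite -restr_prepend take_restr => Dk.
by exists (minn k (size s + m)).
Qed.

Lemma prefix_free_eq W s t X : prefix_free W -> W s -> W t ->
  cylinder s X -> cylinder t X -> s = t.
Proof.
move=> pW Ws Wt sX tX; case: (leqP (size s) (size t)) => [st|/ltnW ts].
  by apply: pW => //; exact: cylinder_prefix tX st.
by apply/esym/pW => //; exact: cylinder_prefix sX ts.
Qed.

Lemma prepend_inj s : injective (prepend s).
Proof.
move=> Y Y' YY'; apply/funext => n.
by have := congr1 (@^~ (size s + n)) YY'; rewrite /prepend ltnNge leq_addr /= addKn.
Qed.

Lemma cylinder_cat s t X : cylinder (s ++ t) X <-> exists2 Y, X = prepend s Y & cylinder t Y.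
Proof.
split=> [stX|[Y -> tY]]; last first.
  by rewrite /cylinder /= size_cat restr_prepend (tY : restr Y (size t) = t).
have stX' : restr X (size (s ++ t)) = s ++ t := stX.
have sX : cylinder s X.
  rewrite /cylinder /= -(@restr_take _ _ (size (s ++ t))) ?size_cat ?leq_addr //.
  by rewrite -size_cat stX' take_size_cat.
have [Y XY] := cylinder_prependP sX; exists Y => //.
move: stX'; rewrite XY size_cat restr_prepend => /eqP.
by rewrite eqseq_cat // eqxx /= => /eqP.
Qed.

Lemma cylinder_inhabited s : exists X, cylinder s X.
Proof. by exists (prepend s (fun=> false)); exact: cylinder_prepend. Qed.

Lemma prefix_cylinder s t X : prefix s t -> cylinder t X -> cylinder s X.
Proof. by move=> /prefixP[u ->] /cylinder_cat[Y -> _]; exact: cylinder_prepend. Qed.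

(** A point of the smaller cylinder lies in both, so [prefix_free_eq] identifies the first factors
    and then, on the common tail, the second ones. *)
Lemma concat_prefix_free W W' : prefix_free W -> prefix_free W' -> prefix_free (concat W W').
Proof.
move=> pW pW' _ _ [s [t [Ws Wt ->]]] [s' [t' [Ws' Wt' ->]]] st.
have [X stX'] := cylinder_inhabited (s' ++ t').
have stX := prefix_cylinder st stX'.
have [[Y XY tY] [Y' XY' tY']] := ((cylinder_cat _ _ _).1 stX, (cylinder_cat _ _ _).1 stX').
have ss' : s = s'.
  apply: (prefix_free_eq (X := X) pW) => //; first by rewrite XY; exact: cylinder_prepend.
  by rewrite XY'; exact: cylinder_prepend.
have YY' : Y = Y' by apply: (@prepend_inj s); rewrite -XY XY' ss'.
by rewrite ss' (prefix_free_eq pW' Wt Wt' tY) // YY'.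
Qed.

Lemma set_bool (W : set string) : exists D : string -> bool, W = (fun s => D s).
Proof. by exists (fun s => `[< W s >]); apply/funext => s; rewrite asboolE. Qed.

Section measure.
Context {R : realType} (mu : probability cantorM R).
Hypothesis mu_uniform : uniform_measure mu.

Local Open Scope ring_scope.
Local Open Scope ereal_scope.

Lemma measurable_cylinder s : measurable (cylinder s : set cantorM).
Proof. by apply: sub_sigma_algebra; exists s. Qed.

Lemma mu_bigcup_le (F : nat -> set cantorM) : (forall k, measurable (F k)) ->
  mu (\bigcup_k F k) <= \sum_(k <oo) mu (F k).
Proof. by move=> mF; apply: measure_sigma_subadditive => //; exact: bigcupT_measurable. Qed.

(** Open classes become unions over all naturals, with empty pieces at the codes outside [D], so
    that series indexed by [nat] apply. *)
Definition piece (s : string) (D : string -> bool) (k : nat) : set cantorM :=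
  if D (decode k) then cylinder (s ++ decode k) else set0.

Definition weight (D : string -> bool) (k : nat) : R :=
  if D (decode k) then (2^-1 ^+ size (decode k))%R else 0%R.

Lemma weight_ge0 (D : string -> bool) k : (0 <= weight D k)%R.
Proof. by rewrite /weight; case: ifP => // _; rewrite exprn_ge0 // invr_ge0. Qed.

Lemma measurable_piece s (D : string -> bool) k : measurable (piece s D k).
Proof. by rewrite /piece; case: ifP => // _; exact: measurable_cylinder. Qed.

Lemma bigcup_piece s (D : string -> bool) :
  \bigcup_k piece s D k = open_class [set s ++ t | t in [set t | D t]].
Proof.
apply/seteqP; split=> X.
  move=> [k _]; rewrite /piece; case: ifP => // Dk Xk.
  by exists (s ++ decode k) => //; exists (decode k).
move=> [_ [t /= Dt <-] Xt]; exists (code t) => //.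
by rewrite /piece codeK Dt.
Qed.

Lemma open_class_piece (D : string -> bool) : open_class D = \bigcup_k piece [::] D k.
Proof.
rewrite bigcup_piece; congr open_class; apply/seteqP; split=> [t Dt|_ [t Dt <-] //].
by exists t.
Qed.

Lemma measurable_open_class (W : set string) : measurable (open_class W : set cantorM).
Proof.
have [D ->] := set_bool W.
by rewrite open_class_piece; apply: bigcupT_measurable => k; exact: measurable_piece.
Qed.

Lemma mu_piece s (D : string -> bool) k : mu (piece s D k) = (2^-1 ^+ size s * weight D k)%:E.
Proof.
rewrite /piece /weight; case: ifP => _; last by rewrite measure0 mulr0.
by rewrite mu_uniform size_cat exprD.
Qed.

Lemma trivIset_piece s (D : string -> bool) : prefix_free D -> trivIset setT (piece s D).
Proof.
move=> pD; apply/trivIsetP => i j _ _ ij; rewrite /piece.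
case: ifP => Di; case: ifP => Dj; rewrite ?set0I ?setI0 //.
apply/seteqP; split=> // X [/cylinder_cat[Y XY Yi] /cylinder_cat[Y' XY' Yj]].
case/eqP: ij; rewrite -(decodeK i) -(decodeK j); congr code.
have YY' : Y = Y' by apply: (@prepend_inj s); rewrite -XY.
by apply: (prefix_free_eq pD Di Dj Yi); rewrite YY'.
Qed.

Definition weight_series (D : string -> bool) : \bar R := \sum_(k <oo) (weight D k)%:E.

Lemma mu_cat_open s (D : string -> bool) : prefix_free D ->
  mu (open_class [set s ++ t | t in [set t | D t]]) = (2^-1 ^+ size s)%:E * weight_series D.
Proof.
move=> pD; rewrite -bigcup_piece measure_bigcup //; last 2 first.
- by move=> k _; exact: measurable_piece.
- exact: trivIset_piece.
rewrite -nneseriesZl; last by move=> k _; rewrite lee_fin weight_ge0.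
rewrite (eq_eseriesl (Q := xpredT)); last by move=> k; rewrite in_setT.
by apply: eq_eseriesr => k _; rewrite -EFinM; exact: mu_piece.
Qed.

Lemma mu_open_class (D : string -> bool) : prefix_free D -> mu (open_class D) = weight_series D.
Proof.
by move=> /(mu_cat_open [::]); rewrite -bigcup_piece -open_class_piece expr0 mul1e.
Qed.

Lemma weight_partial_le (D : string -> bool) T : prefix_free D ->
  (\sum_(0 <= k < T) weight D k)%:E <= mu (open_class D).
Proof.
move=> /mu_open_class ->; rewrite -sumEFin; apply: nneseries_lim_ge => k _.
by rewrite lee_fin weight_ge0.
Qed.

Lemma weight_partial_gt (D : string -> bool) x : prefix_free D ->
  (x < mu (open_class D)) -> exists T, x < (\sum_(0 <= k < T) weight D k)%:E.
Proof.
move=> pD; apply: contraPP => /forallNP H; apply/negP; rewrite -leNgt mu_open_class //.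
apply: lime_le; first by apply: is_cvg_nneseries => k _ _; rewrite lee_fin weight_ge0.
by apply: nearW => T; rewrite sumEFin leNgt; apply/negP.
Qed.

Lemma open_class_cat_shift (D : string -> bool) s :
  open_class [set s ++ t | t in [set t | first_hit (fun t => has_prefix D (s ++ t)) t]] =
  open_class D `&` cylinder s.
Proof.
apply/seteqP; split=> X.
  move=> [_ [t Ht <-]] /cylinder_cat[Y -> Yt]; split; last exact: cylinder_prepend.
  by apply/open_prepend; rewrite -open_first_hit; exists t.
move=> [DX /cylinder_prependP[Y XY]]; move: DX; rewrite XY.
move=> /(open_prepend _ _ _).1; rewrite -open_first_hit.
by move=> [t Ht Yt]; exists (s ++ t); [exists t|apply/cylinder_cat; exists Y].
Qed.

(** Self-similarity of [mu]: the conditional measure given [cylinder s] is the measure of the class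
    of tails. Passing to minimal strings presents the intersection as a prefix-free set translated
    by [s]. *)
Lemma mu_shift (D : string -> bool) s :
  mu (open_class D `&` cylinder s) =
  (2^-1 ^+ size s)%:E * mu (open_class (fun t => has_prefix D (s ++ t))).
Proof.
rewrite -open_class_cat_shift mu_cat_open; last exact: first_hit_prefix_free.
by rewrite -open_first_hit mu_open_class //; exact: first_hit_prefix_free.
Qed.

Lemma mu_concat_le (W W' : set string) : prefix_free W -> prefix_free W' ->
  mu (open_class (concat W W')) <= mu (open_class W) * mu (open_class W').
Proof.
have [[D ->] [D' ->]] := (set_bool W, set_bool W') => pD pD'.
pose F k : set cantorM := if D (decode k) then
  open_class [set decode k ++ t | t in [set t | D' t]] else set0.
have -> : open_class (concat D D') = \bigcup_k F k.
  apply/seteqP; split=> X.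
    move=> [_ [s [t [Ds Dt ->]]] Xst]; exists (code s) => //.
    by rewrite /F codeK Ds; exists (s ++ t) => //; exists t.
  move=> [k _]; rewrite /F; case: ifP => // Dk [_ [t D't <-] Xt].
  by exists (decode k ++ t) => //; exists (decode k), t.
have mF k : measurable (F k).
  by rewrite /F; case: ifP => // _; exact: measurable_open_class.
apply: le_trans (mu_bigcup_le mF) _.
have finD' : mu (open_class D') \is a fin_num.
  exact: fin_num_measure (measurable_open_class _).
rewrite (mu_open_class pD) -(fineK finD') muleC -nneseriesZl; last first.
  by move=> k _; rewrite lee_fin weight_ge0.
apply: lee_nneseries => // k _; rewrite /F /weight; case: ifP => Dk.
  by rewrite mu_cat_open // -mu_open_class // fineK // muleC.
by rewrite measure0 mule0.
Qed.

(** Kraft's inequality bounds the weight of [D] by 1, and each image is at least [n] bits longer.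
    The images may overlap, so subadditivity is used. *)
Lemma mu_image_le n (D : string -> bool) (g : string -> string) : prefix_free D ->
  (forall p, D p -> size p + n <= size (g p))%N ->
  mu (open_class [set g p | p in [set p | D p]]) <= (2^-1 ^+ n)%:E.
Proof.
move=> pD gD.
pose F k : set cantorM := if D (decode k) then cylinder (g (decode k)) else set0.
have -> : open_class [set g p | p in [set p | D p]] = \bigcup_k F k.
  apply/seteqP; split=> X.
    by move=> [_ [p Dp <-] Xp]; exists (code p) => //; rewrite /F codeK (Dp : is_true (D p)).
  move=> [k _]; rewrite /F; case: ifP => // Dk Xk.
  by exists (g (decode k)) => //; exists (decode k).
have mF k : measurable (F k).
  by rewrite /F; case: ifP => // _; exact: measurable_cylinder.
apply: le_trans (mu_bigcup_le mF) _.
apply: (@le_trans _ _ ((2^-1 ^+ n)%:E * weight_series D)).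
  rewrite -nneseriesZl; last by move=> k _; rewrite lee_fin weight_ge0.
  apply: lee_nneseries => // k _; rewrite /F /weight; case: ifP => Dk.
    rewrite mu_uniform -EFinM lee_fin -exprD.
    apply: ler_wiXn2l; rewrite ?invr_ge0 ?invf_le1 ?ler1n //.
    by rewrite addnC gD.
  by rewrite measure0 mule0.
rewrite -mu_open_class // -[leRHS]mule1; apply: lee_pmul => //.
exact: probability_le1 (measurable_open_class _).
Qed.

(** The bound on [l] makes the truncated exponent in [weight_sum] exact; it holds for lengths
    because the string with code [k] has at most [k] letters. *)
Lemma weight_sumE (b : nat -> bool) (l : nat -> nat) T :
  (forall k, l k <= k.+1)%N ->
  (weight_sum b l T)%:R = (2 ^+ T * \sum_(0 <= k < T) (if b k then 2^-1 ^+ l k else 0))%R :> R.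
Proof.
move=> lk; elim: T => [|T IH]; first by rewrite big_nil mulr0.
rewrite big_nat_recr //= mulrDr exprS -!mulrA -IH natrD natrM; congr (_ + _)%R.
case: ifP => _; last by rewrite !mulr0.
by rewrite natrX mulrA -exprS exprVn -{2}(subnK (lk T)) exprD mulfK.
Qed.
End measure.

(** * Complexity tests *)

(** Some program is short enough exactly when a shortest one is, which removes the minimum and
    leaves an enumerable condition. *)
Lemma S_classE U A n : S_class U A n =
  open_class [set s | exists p, runs U A p s /\ size p + n <= size s].
Proof.
apply/seteqP; split=> X.
  move=> [m [k [[[p [Hp <-]] _] pm]]]; apply/open_classP; exists m, p.
  by rewrite size_restr.
move=> /open_classP[m [p [Hp pm]]]; rewrite size_restr in pm.
pose P k := `[< exists p, runs U A p (restr X m) /\ size p = k >].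
have exP : exists k, P k by exists (size p); apply/asboolP; exists p.
exists m; case: (ex_minnP exP) => k /asboolP Pk mink; exists k; split.
  split=> // q Hq; apply: mink; apply/asboolP; by exists q.
by apply: leq_trans pm; rewrite leq_add2r; apply: mink; apply/asboolP; exists p.
Qed.

Lemma uniformly_re_S_class U A :
  uniformly_re A (fun n s => exists p, runs U A p s /\ size p + n <= size s).
Proof.
apply: (uniformly_re_enum (P := fun B v =>
  has (fun k => (steval B (nth 0 v 0) U [:: k] == (nth 0 v 2).+1) &&
    (size (decode k) + nth 0 v 1 <= size (decode (nth 0 v 2)))) (iota 0 (nth 0 v 0).+1))).
  apply: computable_has; first by comp_arith.
  apply: computable_and; last by comp_arith.
  by apply: computable_eq; [apply: computable_steval1|]; comp_arith.
move=> n s; split.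
  move=> [p [/steval_complete[t Ht] pn]]; exists (maxn t (code p)).
  apply/(has_nthP 0); exists (code p); first by rewrite size_iota ltnS leq_maxr.
  by rewrite nth_iota ?ltnS ?leq_maxr // add0n Ht ?leq_maxl // eqxx !codeK.
move=> [t /(has_nthP 0)[k _ /andP[/eqP Hk kn]]].
exists (decode (nth 0 (iota 0 t.+1) k)); split; last by rewrite codeK in kn.
by rewrite /runs decodeK; exact: steval_sound Hk.
Qed.

(** * Dyadic intervals and bounded maxima *)

(** Most significant bit first, unlike [code]: [p] stands for the dyadic interval from
    [binary_value p] to its successor, divided by [2 ^ size p], and appending bits refines it. *)
Definition binary_value (p : string) : nat := foldl (fun z (b : bool) => 2 * z + b) 0 p.

Lemma binary_value_rcons p b : binary_value (rcons p b) = 2 * binary_value p + b.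
Proof. by rewrite /binary_value foldl_rcons. Qed.

Lemma binary_value_cat p q :
  binary_value p * 2 ^ size q <= binary_value (p ++ q) < (binary_value p).+1 * 2 ^ size q.
Proof.
elim/last_ind: q => [|q b]; first by rewrite cats0 !muln1 leqnn ltnSn.
rewrite -rcons_cat binary_value_rcons size_rcons expnS.
move: (binary_value p) (binary_value _) (2 ^ _) => x y z /andP[xy yx].
by case: b => /=; nia.
Qed.

Lemma binary_value_surj l v : v < 2 ^ l -> exists p, size p = l /\ binary_value p = v.
Proof.
elim: l v => [|l IH] v; first by rewrite ltnS leqn0 => /eqP ->; exists [::].
move=> vl; have [|p [sp pv]] := IH v./2; first by rewrite expnS in vl; lia.
by exists (rcons p (odd v)); rewrite size_rcons sp binary_value_rcons pv; split=> //; lia.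
Qed.

Lemma computable_odd n F : computable n F -> computable n (fun A v => odd (F A v) : nat).
Proof.
move=> cF; have := computable_neg (computable_eq cF
  (computable_mul (computable_cst _ 2) (computable_half cF))).
by apply: computable_ext => A v _; congr nat_of_bool; case: eqP; lia.
Qed.

Lemma computable_binary_value n S : scomputable n S ->
  computable n (fun A v => binary_value (S A v)).
Proof.
move=> cS; suff : computable n (fun A v => binary_value (decode (code (S A v)))).
  by apply: computable_ext => A v _; rewrite codeK.
move: cS; apply: (computable_op1 (op := fun c => binary_value (decode c))).
apply: computable_ext (computable_rec (N := fun _ v => size (decode (nth 0 v 0)))
  (B := fun _ _ => 0)
  (St := fun _ v k z => 2 * z + odd (code (drop k (decode (nth 0 v 0)))).-1) _ _ _)
  => [A v _|||]; [|by comp_arith..|]; last first.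
  apply: computable_add; first by comp_arith.
  by apply: computable_odd; comp_arith.
move: (decode _) => p; rewrite -[in RHS](take_size p).
suff H k : k <= size p -> nat_rect (fun _ => nat) 0
    (fun k z => 2 * z + odd (code (drop k p)).-1) k = binary_value (take k p) by exact: H.
elim: k => [|k IH] kp; first by rewrite take0.
rewrite (take_nth false kp) binary_value_rcons -IH ?(ltnW kp) //=.
by rewrite (drop_nth false kp) /= oddD odd_double addbF oddb.
Qed.

Definition last_true (P : nat -> bool) (n : nat) : nat :=
  nat_rect (fun _ => nat) 0 (fun k z => if P k.+1 then k.+1 else z) n.

Lemma last_true_le (P : nat -> bool) n : last_true P n <= n.
Proof. by elim: n => //= n IH; case: ifP => // _; exact: leqW. Qed.

Lemma last_true_ge (P : nat -> bool) n m : 0 < m <= n -> P m -> m <= last_true P n.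
Proof.
move=> /andP[m0] + Pm; elim: n => /= [|n IH]; first by rewrite leqNgt m0.
rewrite leq_eqVlt => /predU1P[<-|]; first by rewrite Pm.
by move=> mn; case: ifP => // _; [exact: ltnW|exact: IH].
Qed.

Lemma last_trueP (P : nat -> bool) n : 0 < last_true P n -> P (last_true P n).
Proof. by elim: n => //= n IH; case: ifP. Qed.

Section tests.
Context {R : realType} (mu : probability cantorM R).
Hypothesis mu_uniform : uniform_measure mu.

Local Open Scope ring_scope.
Local Open Scope ereal_scope.

Lemma S_class_test U A : prefix_free_machine U -> ML_test mu A (S_class U A).
Proof.
move=> pU; split.
  by eexists; split; [exact: uniformly_re_S_class|exact: S_classE].
move=> n; pose g p := xget [::] [set s | runs U A p s].
have gE p s : runs U A p s -> g p = s.
  move=> ps; rewrite /g; case: xgetP => [t _ /= pt|/(_ s)//].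
  exact: code_inj (eval_inj pt ps).
pose D p := `[< exists s, runs U A p s /\ (size p + n <= size s)%N >].
have -> : S_class U A n = open_class [set g p | p in [set p | D p]].
  rewrite S_classE; congr open_class; apply/seteqP; split=> s.
    by move=> [p [ps pn]]; exists p; [apply/asboolP; exists s|exact: gE].
  by move=> [p /asboolP[t [pt pn]] <-]; exists p; rewrite (gE _ _ pt).
apply: (mu_image_le mu_uniform).
  by move=> p q /asboolP[s [ps _]] /asboolP[t [qt _]]; apply: (pU A); [exists s|exists t].
by move=> p /asboolP[s [ps pn]]; rewrite (gE _ _ ps).
Qed.

(** ** Compressing the members of a test *)

Section shannon_fano.
Variable D : cantor_space -> nat -> string -> bool.
Hypothesis D_dec : decidable_family D.

(* If [u] belongs to several of the sets, only the best saving is requested. *)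
Definition saving A u := last_true (fun m => D A (2 * m) u) (size u).
Definition request A i := (0 < saving A (decode i))%N.
Definition request_length A i := (size (decode i) - saving A (decode i))%N.
Definition requested A i : nat := weight_sum (request A) (request_length A) i.

(* [p] describes [i] if its dyadic interval lies inside the [i]-th requested interval:
   these are laid out side by side, so that the partial sums are their endpoints. *)
Definition describes A p i : bool :=
  [&& request A i, size p == (request_length A i).+1,
    requested A i * 2 ^ size p <= binary_value p * 2 ^ i &
    (binary_value p).+1 * 2 ^ i.+1 <= requested A i.+1 * 2 ^ size p]%N.

Lemma computable_saving n S : scomputable n S ->
  computable n (fun A v => saving A (S A v)).
Proof.
move=> cS; suff cI : computable 1 (fun A v => saving A (decode (nth 0%N v 0))).
  apply: computable_ext (computable_subst cI (Fs := [:: fun A v => code (S A v)]) erefl _) => //.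
  by move=> A v _ /=; rewrite codeK.
apply: (computable_rec (B := fun _ _ => 0%N)
  (St := fun A v k z => if D A (2 * k.+1)%N (decode (nth 0%N v 0)) then k.+1 else z)).
- by comp_arith.
- by comp_arith.
apply: (computable_if (P := fun A w =>
  D A (2 * (nth 0 w 0).+1)%N (decode (nth 0%N (behead (behead w)) 0)))).
- by apply: computable_family => //; comp_arith.
- by comp_arith.
- by comp_arith.
Qed.

Lemma computable_requested n N : computable n N ->
  computable n (fun A v => requested A (N A v)).
Proof.
apply: (computable_weight_sum (b := fun A _ k => request A k)
  (l := fun A _ k => request_length A k)).
  by apply: computable_leq; [|apply: computable_saving]; comp_arith.
by apply: computable_sub; [|apply: computable_saving]; comp_arith.
Qed.

Lemma computable_describes :
  computable 2 (fun A v => describes A (decode (nth 0%N v 1)) (nth 0%N v 0) : nat).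
Proof.
have cL n N : computable n N -> computable n (fun A v => request_length A (N A v)).
  move=> cN; apply: computable_sub; first exact/computable_size/scomputable_decode.
  exact/computable_saving/scomputable_decode.
apply: computable_and.
  by apply: computable_leq; [|apply: computable_saving]; comp_arith.
apply: computable_and.
  by apply: computable_eq; [|apply: computableS; apply: cL]; comp_arith.
apply: computable_and; apply: computable_leq; apply: computable_mul;
  do ?[apply: computableS; apply: computable_binary_value | apply: computable_binary_value
      | apply: computable_requested]; comp_arith.
Qed.

Definition total A i : R :=
  \sum_(0 <= k < i) (if request A k then 2^-1 ^+ request_length A k else 0)%R.

Lemma requestedE A i : (requested A i)%:R = (2 ^+ i * total A i)%R :> R.
Proof.
apply: weight_sumE => k; rewrite /request_length leqW // -[leqRHS](decodeK k).
by rewrite (leq_trans (leq_subr _ _)) // size_le_code.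
Qed.

Lemma total_le A i j : (i <= j)%N -> (total A i <= total A j)%R.
Proof.
move=> ij; rewrite /total [leRHS](big_cat_nat (n := i)) //= lerDl sumr_ge0 // => k _.
by case: ifP => // _; rewrite exprn_ge0 // invr_ge0.
Qed.

Lemma totalS A i : request A i -> (total A i.+1 = total A i + 2^-1 ^+ request_length A i)%R.
Proof. by move=> ri; rewrite /total big_nat_recr //= ri. Qed.

Lemma describesE A p i : describes A p i =
  [&& request A i, size p == (request_length A i).+1,
    (total A i <= (binary_value p)%:R / 2 ^+ size p)%R &
    ((binary_value p).+1%:R / 2 ^+ size p <= total A i.+1)%R].
Proof.
have pos n : (0 < 2 ^+ n :> R)%R by rewrite exprn_gt0.
rewrite /describes; congr [&& _, _, _ & _].
  rewrite ler_pdivlMr // -(ler_nat R) !natrM !natrX requestedE -mulrA mulrC.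
  by rewrite ler_pM2r.
rewrite ler_pdivrMr // -(ler_nat R) !natrM !natrX requestedE -mulrA mulrC ler_pM2l //.
Qed.

(** The left endpoint of the interval of [q] lies in that of [p], hence in the [i]-th and the [j]-th
    requested intervals. Those are disjoint for [i <> j] because [total] is monotone; this works for
    every oracle. *)
Lemma describes_prefix A p q i j : prefix p q -> describes A p i -> describes A q j -> i = j.
Proof.
move=> /prefixP[u ->{q}]; rewrite !describesE size_cat exprD.
have pos n : (0 < 2 ^+ n :> R)%R by rewrite exprn_gt0.
have /andP[] := binary_value_cat p u.
rewrite -(ler_nat R) -(ltr_nat R) !natrM !natrX.
rewrite -[(binary_value p).+1%:R%R]natr1 -[(binary_value (p ++ u)).+1%:R%R]natr1.
set v := ((binary_value p)%:R : R)%R; set w := ((binary_value _)%:R : R)%R.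
move: (pos (size p)) (pos (size u)).
set x := (2 ^+ size p)%R; set y := (2 ^+ size u)%R => x0 y0 vw wv.
move=> /and4P[_ _ ip pi] /and4P[_ _ jq qj].
have lo : (v / x <= w / (x * y))%R.
  have -> : (v / x = v * y / (x * y))%R by field; rewrite !gt_eqF.
  by rewrite ler_pM2r // invr_gt0 mulr_gt0.
have hi : (w / (x * y) < (v + 1) / x)%R.
  by rewrite ltr_pdivrMr ?mulr_gt0 // mulrA divfK ?gt_eqF.
have w1 : (w / (x * y) < (w + 1) / (x * y))%R.
  by rewrite ltr_pM2r ?invr_gt0 ?mulr_gt0 // ltrDl.
case: (ltngtP i j) => // [/total_le|/total_le] => /(_ A) T; exfalso; lra.
Qed.

(** An interval of length [2 ^ - l] contains a dyadic one of half that length, which is why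
    descriptions have one bit more than requested. *)
Lemma describes_exists A i : request A i -> (total A i.+1 <= 1)%R ->
  exists p, describes A p i.
Proof.
move=> ri; set l := request_length A i => T1.
have pos n : (0 < 2 ^+ n :> R)%R by rewrite exprn_gt0.
have T0 : (0 <= total A i)%R.
  by apply: sumr_ge0 => k _; case: ifP => // _; rewrite exprn_ge0 // invr_ge0.
pose x := (total A i * 2 ^+ l.+1)%R.
have x0 : (0 <= x)%R by rewrite mulr_ge0 // ltW.
(* In units of [2 ^ - l.+1] the requested interval is [[x, x + 2]], so it contains [[v, v + 1]]. *)
have [v [xv vx]] : exists v : nat, (x <= v%:R /\ v%:R <= x + 1)%R.
  exists (Num.truncn x).+1; have /andP[vx xv] := Num.Theory.truncn_itv x0.
  by rewrite ltW //= -natr1 lerD2r.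
have TS : (total A i.+1 = total A i + 2 / 2 ^+ l.+1)%R.
  by rewrite totalS // exprS invfM mulrA divff ?pnatr_eq0 // mul1r exprVn.
have v1 : (v.+1%:R / 2 ^+ l.+1 <= total A i.+1)%R.
  rewrite TS ler_pdivrMr // mulrDl divfK ?gt_eqF // -natr1 -/x.
  by rewrite (_ : 2 = 1 + 1)%R // addrA lerD2r.
have [|p [sp pv]] := @binary_value_surj l.+1 v.
  rewrite -(ler_nat R) natrX -[leRHS]mul1r -ler_pdivrMr //.
  exact: le_trans v1 T1.
exists p; rewrite describesE ri sp eqxx /= pv v1 andbT.
by rewrite ler_pdivlMr.
Qed.

Section bounded.
Variable A : cantor_space.
Hypothesis D_pf : forall m, prefix_free (D A m).
Hypothesis D_small : forall m, mu (open_class (D A m)) <= (2^-1 ^+ m)%:E.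

(** A saving of [m] bits multiplies a weight by [2 ^ m], while the class with index [2 * m] has
    measure at most [2 ^ - (2 * m)]; what remains is a geometric series over [m >= 1]. *)
Lemma total_le1 T : (total A T <= 1)%R.
Proof.
pose B : R := (\sum_(0 <= m < T) 2 ^+ m.+1 * \sum_(0 <= k < T) weight (D A (2 * m.+1)) k)%R.
apply: (@le_trans _ _ B); rewrite /B.
  under [leRHS]eq_bigr do rewrite mulr_sumr.
  rewrite exchange_big_nat /=; apply: ler_sum_nat => k /andP[_ kT].
  have w0 m : (0 <= 2 ^+ m.+1 * weight (D A (2 * m.+1)) k :> R)%R.
    by rewrite mulr_ge0 ?exprn_ge0 // weight_ge0.
  case: ifP => [rk|_]; last exact: sumr_ge0.
  rewrite /request in rk; rewrite /request_length.
  have sk : (saving A (decode k) <= size (decode k))%N := last_true_le _ _.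
  have kk : (size (decode k) <= k)%N by rewrite -[leqRHS](decodeK k) size_le_code.
  have Ds : D A (2 * saving A (decode k)) (decode k) :=
    @last_trueP (fun m => D A (2 * m)%N (decode k)) _ rk.
  move: (saving A (decode k)) sk Ds rk => s sk Ds s0.
  (* The request of [k] is paid for by the single summand of its own saving [s]; the index is
     shifted by one. *)
  rewrite (bigD1_seq s.-1) ?iota_uniq //=; last by rewrite mem_index_iota; lia.
  rewrite prednK // /weight Ds -[leLHS]addr0 lerD ?sumr_ge0 //.
  rewrite -{2}(subnK sk) [in leRHS]exprD mulrCA -exprMn divff ?pnatr_eq0 //.
  by rewrite expr1n mulr1.
apply: (@le_trans _ _ (\sum_(0 <= m < T) 2^-1 ^+ m.+1 : R)%R).
  apply: ler_sum_nat => m _.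
  rewrite -ler_pdivlMl ?exprn_gt0 // -exprVn -exprD addnn -mul2n -lee_fin.
  have W := weight_partial_le mu_uniform T (@D_pf (2 * m.+1)%N).
  exact: le_trans W (D_small _).
have -> : (\sum_(0 <= m < T) 2^-1 ^+ m.+1 = 1 - 2^-1 ^+ T :> R)%R.
  elim: (T) => [|m IH]; first by rewrite big_nil expr0 subrr.
  by rewrite big_nat_recr //= IH exprS; field.
by rewrite lerBlDr lerDl.
Qed.

(** Guarantees that the bound [size u] on the search in [saving] misses no index. *)
Lemma size_bound m u : D A m u -> (m <= size u)%N.
Proof.
move=> Du; rewrite -(@ler_iXn2l R 2^-1) ?invr_gt0 ?invf_lt1 ?ltr1n //.
rewrite -lee_fin -mu_uniform; apply: le_trans (D_small m).
apply: le_measure; rewrite ?inE; [exact: measurable_cylinder|exact: measurable_open_class|].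
by move=> X uX; exists u.
Qed.

End bounded.

Lemma test_le_S_class A U n :
  universal_machine U -> (forall m, prefix_free (D A m)) ->
  (forall m, mu (open_class (D A m)) <= (2^-1 ^+ m)%:E) ->
  exists m, open_class (D A m) `<=` S_class U A n.
Proof.
move=> [_ univU] pD smallD.
(* The machine searches for the number that its input describes; this number is the code of the
   output string. *)
have [M HM] := computable_search computable_describes.
have runM B p s : runs M B p s -> describes B p (code s).
  by move=> /(HM B [:: code p] erefl)[/= + _]; rewrite codeK.
have pfM : prefix_free_machine M.
  move=> B p q [s /runM ps] [t /runM qt] pq.
  have st := describes_prefix pq ps qt.
  move: ps qt pq; rewrite /describes -st prefixE.
  move=> /and4P[_ /eqP -> _ _] /and4P[_ /eqP sq _ _] /eqP.
  by rewrite take_oversize ?sq.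
have [c Hc] := univU M pfM.
(* The saving must cover [n], the simulation constant [c], and the extra bit of a description. *)
exists (2 * (n + c).+1)%N => X /open_classP[j].
set u := restr X j => Du; set s := saving A u.
have su := size_bound smallD Du.
have ms : ((n + c).+1 <= s)%N.
  by apply: last_true_ge => //; rewrite ltn0Sn; lia.
have us : (s <= size u)%N := last_true_le _ _.
have req : request A (code u) by rewrite /request codeK; lia.
have [p Hp] := describes_exists req (total_le1 pD smallD _).
have Mp : runs M A p u.
  apply/(HM A [:: code p] erefl); rewrite /= codeK; split=> // k ku.
  apply/negP => Hk; move: ku.
  by rewrite (describes_prefix (prefix_refl p) Hk Hp) ltnn.
have [q [Uq qp]] := Hc A p u Mp.
rewrite S_classE; apply/open_classP; exists j, q; split=> //; rewrite -/u.
have /and4P[_ /eqP sp _ _] := Hp.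
by move: qp; rewrite sp /request_length codeK -/s; lia.
Qed.
End shannon_fano.

Lemma test_sub_S_class U A V n : universal_machine U -> ML_test mu A V ->
  exists m, V m `<=` S_class U A n.
Proof.
move=> univU [[W [reW VW]] smallV].
have [D [D_dec D_pf DW]] := uniformly_re_normal reW.
have [m Hm] : exists m, open_class (D A m) `<=` S_class U A n.
  by apply: test_le_S_class => // m; rewrite -DW -VW.
by exists m; rewrite VW DW.
Qed.

Lemma compl_S_class_random U A n : universal_machine U ->
  ~` S_class U A n `<=` random mu A.
Proof.
move=> univU X SX V testV VX; have [m Vm] := test_sub_S_class n univU testV.
by apply: SX; apply: Vm; apply: VX.
Qed.
End tests.

(** * From decidable families to enumerable sets and back *)

Lemma re_decidable (P : cantor_space -> string -> bool) A :
  computable 1 (fun B v => P B (decode (nth 0 v 0)) : nat) -> re A (P A).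
Proof.
move=> cP; apply: (re_enum (P := fun B v => P B (decode (nth 0 (behead v) 0)))).
  exact: (computable_splice (n := 1) (k := 1) (Fs := [::]) cP).
by move=> s; split=> [Ps|[t]]; [exists 0|]; rewrite /= codeK.
Qed.

Lemma uniformly_re_decidable (P : cantor_space -> nat -> string -> bool) A :
  decidable_family P -> uniformly_re A (P A).
Proof.
move=> cP; apply: (uniformly_re_enum (P := fun B v =>
  P B (nth 0 (behead v) 0) (decode (nth 0 (behead v) 1)))).
  exact: (computable_splice (n := 2) (k := 1) (Fs := [::]) cP).
by move=> n s; split=> [Ps|[t]]; [exists 0|]; rewrite /= codeK.
Qed.

Lemma sigma01_normal A U : sigma01 A U -> exists D,
  [/\ decidable_family D, forall B m, prefix_free (D B m) & U = open_class (D A 0)].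
Proof.
move=> [W [/re_uniformly_re/uniformly_re_normal[D [cD pD DW]] ->]].
by exists D; split => //; rewrite -(DW 0).
Qed.

Lemma uniformly_re_index A W g : computable 1 (fun _ v => g (nth 0 v 0)) ->
  uniformly_re A W -> uniformly_re A (fun n => W (g n)).
Proof.
move=> [h hg] [f fW]; exists (Comp f [:: Comp h [:: Proj 0]; Proj 1]) => n s.
have hE z : eval A (Comp h [:: Proj 0]) [:: n; code s] z <-> z = g n.
  rewrite eval_Comp; split.
    by move=> [[|x [|??]] [//= [-> []]]]; rewrite hg.
  by move=> ->; exists [:: n]; split=> //; rewrite hg.
rewrite fW; split=> -[y].
  move=> Hy; exists y; rewrite eval_Comp; exists [:: g n; code s]; split=> //=.
  by split=> //; apply/hE.
rewrite eval_Comp => -[[|x [|x' [|??]]] [//= [/hE -> []]]] // -> _ Hy; by exists y.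
Qed.

(** * Powers *)

Fixpoint join (a : nat -> string) (j : nat) : string :=
  if j is i.+1 then join a i ++ a i else [::].

Lemma eq_join a b j : (forall i, i < j -> a i = b i) -> join a j = join b j.
Proof. by elim: j => //= j IH ab; rewrite IH ?ab // => i ij; rewrite ab // ltnW. Qed.

Lemma concat_powP W j u :
  concat_pow W j u <-> exists a, u = join a j /\ forall i, i < j -> W (a i).
Proof.
elim: j u => [|j IH] u /=.
  by split=> [->|[a []]//]; exists (fun=> [::]).
split=> [[s [t [/IH[a [-> Wa]] Wt ->]]]|[a [-> Wa]]].
  exists (fun i => if i == j then t else a i); split.
    rewrite eqxx; congr (_ ++ _); apply: eq_join => i ij.
    by rewrite ltn_eqF.
  move=> i; rewrite ltnS leq_eqVlt => /predU1P[->|ij]; first by rewrite eqxx.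
  by rewrite ltn_eqF //; exact: Wa.
exists (join a j), (a j); split=> //; last exact: Wa.
by apply/IH; exists a; split=> // i ij; apply: Wa; rewrite ltnW.
Qed.

(* [z] lists numbers in binary with [b] digits each. *)
Definition entry (b : nat) (z : string) (i : nat) : nat :=
  binary_value (take b (drop (i * b) z)).

(** Plays the role of Gödel's beta function: quantifying over a finite list becomes quantifying over
    a number and a string. *)
Lemma entry_exists (a : nat -> nat) j :
  exists b z, forall i, i < j -> entry b z i = a i.
Proof.
have [b Hb] : exists b, forall t, b <= t -> forall i, i < j -> a i < 2 ^ t.
  apply: eventually_forall_lt => i _; exists (a i) => t it.
  by apply: leq_ltn_trans it _; exact: ltn_expl.
exists b; suff [z [_ Hz]] : exists z, size z = j * b /\ forall i, i < j -> entry b z i = a i.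
  by exists z.
have {}Hb i : i < j -> a i < 2 ^ b := Hb b (leqnn b) i.
elim: j Hb => [|j IH] Hb; first by exists [::].
have [|z [sz Hz]] := IH; first by move=> i ij; apply: Hb; rewrite ltnW.
have [p [sp pa]] := binary_value_surj (Hb j (ltnSn j)).
exists (z ++ p); split; first by rewrite size_cat sz sp mulSn addnC.
move=> i; rewrite ltnS leq_eqVlt => /predU1P[->|ij].
  by rewrite /entry -sz drop_size_cat // -sp take_size.
have ib : i * b + b <= size z by rewrite sz -mulSnr leq_mul2r ij orbT.
rewrite -Hz // /entry drop_cat; case: ltnP => [_|zb].
  by rewrite takel_cat // size_drop leq_subRL // ?(leq_trans _ ib) ?leq_addr // addnC.
have b0 : b = 0 by lia.
by rewrite b0 !take0.
Qed.

(** One bound [T] limits both the code of the list of factors and the steps for enumerating each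
    factor. Uniformity in the exponent is what lets powers form a test. *)
Lemma uniformly_re_concat_pow A W : re A W -> uniformly_re A (concat_pow W).
Proof.
move=> [f fW].
pose Q B T j u b z := (join (fun i => decode (entry b z i)) j == u) &&
  all (fun i => steval B T f [:: entry b z i] != 0) (iota 0 j).
apply: (uniformly_re_enum (P := fun B v =>
  has (fun b => has (fun c => Q B (nth 0 v 0) (nth 0 v 1) (decode (nth 0 v 2)) b (decode c))
    (iota 0 (nth 0 v 0).+1)) (iota 0 (nth 0 v 0).+1))).
  have cE n b z i : computable n b -> scomputable n z -> computable n i ->
      computable n (fun B v => entry (b B v) (z B v) (i B v)).
    move=> cb cz ci; apply/computable_binary_value/scomputable_take => //.
    by apply: scomputable_drop => //; exact: computable_mul.
  apply: computable_has; first by comp_arith.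
  apply: computable_has; first by comp_arith.
  apply: computable_and; last first.
    apply: computable_all; first by comp_arith.
    apply: computable_neg; apply: computable_eq0; apply: computable_steval1; first by comp_arith.
    by apply: cE; comp_arith.
  apply: computable_seq_eq; last by comp_arith.
  apply: computable_ext (computable_rec (N := fun _ w => nth 0 (behead (behead w)) 1)
    (B := fun _ _ => 0)
    (St := fun _ w i x => code (decode x ++
       decode (entry (nth 0 (behead w) 0) (decode (nth 0 w 0)) i))) _ _ _).
  - move=> B v _; elim: (nth 0 _ 1) => //= k ->.
    by rewrite codeK.
  - by comp_arith.
  - by comp_arith.
  - apply: scomputable_cat; apply: scomputable_decode; first by comp_arith.
    by apply: cE; comp_arith.
move=> j u; rewrite concat_powP; split.
  move=> [a [-> Wa]].
  have [t1 H1] := eventually_forall_lt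
    (P := fun i t => steval A t f [:: code (a i)] != 0) (n := j)
    (fun i ij => let: ex_intro y Hy := (fW (a i)).1 (Wa i ij) in
      let: ex_intro t1 H1 := steval_complete Hy in
      ex_intro _ t1 (fun t tt1 => etrans (congr1 (fun x => x != 0) (H1 t tt1)) erefl)).
  have [b [z Hz]] := entry_exists (fun i => code (a i)) j.
  exists (maxn t1 (maxn b (code z))); set T := maxn _ _.
  apply/(has_nthP 0); exists b; first by rewrite size_iota ltnS /T !leq_max leqnn orbT.
  rewrite nth_iota ?ltnS /T ?leq_max ?leqnn ?orbT // add0n -/T.
  apply/(has_nthP 0); exists (code z); first by rewrite size_iota ltnS /T !leq_max leqnn !orbT.
  rewrite nth_iota ?ltnS /T ?leq_max ?leqnn ?orbT // add0n -/T.
  rewrite !codeK; apply/andP; split.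
    by apply/eqP/eq_join => i ij; rewrite Hz // codeK.
  apply/allP => i; rewrite mem_iota => /andP[_ ij]; rewrite Hz //.
  by apply: H1 => //; rewrite /T leq_maxl.
move=> [T /(has_nthP 0)[b _ /(has_nthP 0)[c _]]].
move: (nth 0 _ b) (decode (nth 0 _ c)) => {}b z /andP[/eqP Hu /allP Ha].
rewrite codeK in Hu; exists (fun i => decode (entry b z i)); split=> // i ij.
have {}Ha := Ha i; rewrite mem_iota ij in Ha.
apply/fW; exists (steval A T f [:: entry b z i]).-1; rewrite decodeK.
by apply: (@steval_sound _ T); rewrite prednK // lt0n; exact: Ha.
Qed.

Lemma concat_pow_prefix_free W j : prefix_free W -> prefix_free (concat_pow W j).
Proof.
by move=> pW; elim: j => [_ _ -> ->|j IH] //; exact: concat_prefix_free.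
Qed.

Section classes.
Context {R : realType} (mu : probability cantorM R).
Hypothesis mu_uniform : uniform_measure mu.

Local Open Scope ring_scope.
Local Open Scope ereal_scope.

Definition prefix_sum (D : string -> bool) T : nat :=
  weight_sum (fun k => D (decode k)) (fun k => size (decode k)) T.

Lemma prefix_sumE D T :
  (prefix_sum D T)%:R = (2 ^+ T * \sum_(0 <= k < T) weight D k)%R :> R.
Proof.
apply: weight_sumE => k.
by rewrite leqW // -[leqRHS](decodeK k) size_le_code.
Qed.

Lemma computable_prefix_sum n (D : cantor_space -> seq nat -> string -> bool) N :
  computable n.+1 (fun A w => D A (behead w) (decode (nth 0%N w 0)) : nat) ->
  computable n N -> computable n (fun A v => prefix_sum (D A v) (N A v)).
Proof.
move=> cD cN; apply: (computable_weight_sum (b := fun A v k => D A v (decode k))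
  (l := fun _ _ k => size (decode k))) => //.
by comp_arith.
Qed.

(** ** Null classes contain no random reals *)

Section full_class.
Variable D : cantor_space -> nat -> string -> bool.
Hypothesis D_dec : decidable_family D.
Hypothesis D_pf : forall B m, prefix_free (D B m).

Definition nearly_full B n T : bool :=
  ((2 ^ T - prefix_sum (D B 0) T) * 2 ^ n <= 2 ^ T)%N.

(** The length of [s] serves as the stage [T]. A string with code below [T] is shorter than [T], so
    the first [T] bits of a real decide whether it avoids the stage-[T] part of the class. *)
Definition residue B n s : bool := nearly_full B n (size s) &&
  all (fun k => ~~ (D B 0 (take k s) && (code (take k s) < size s)%N)) (iota 0 (size s).+1).

Definition truncation B T s : bool := D B 0 s && (code s < T)%N.

Lemma decidable_residue : decidable_family residue.
Proof.
apply: computable_and.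
  rewrite /nearly_full; apply: computable_leq; last by comp_arith.
  apply: computable_mul; last by comp_arith.
  apply: computable_sub; first by comp_arith.
  apply: (computable_prefix_sum (D := fun B _ => D B 0)); last by comp_arith.
  by apply: computable_family => //; comp_arith.
apply: computable_all; first by comp_arith.
apply: computable_neg; apply: computable_and.
  by apply: computable_family => //; comp_arith.
by apply: computable_leq; first apply: computableS; comp_arith.
Qed.

Lemma open_residueP B n X : open_class (residue B n) X <->
  exists2 T, nearly_full B n T & ~ open_class (truncation B T) X.
Proof.
rewrite open_classP; split=> -[T].
  move=> /andP[]; rewrite size_restr => nT /allP H; exists T => // /open_classP[k].
  move=> /andP[Dk kT].
  have kT' : (k < T)%N by rewrite -(size_restr X k) (leq_ltn_trans (size_le_code _)).
  have := H k; rewrite mem_iota add0n ltnS (ltnW kT') => /(_ isT).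
  by rewrite restr_take ?(ltnW kT') // Dk kT.
move=> nT H; exists T; rewrite /residue size_restr nT; apply/allP => k _.
apply/negP; rewrite take_restr => /andP[Dk kT]; apply: H; apply/open_classP.
by exists (minn k T); rewrite /truncation Dk.
Qed.

Lemma truncation_prefix_free B T : prefix_free (truncation B T).
Proof. by move=> s t /andP[Ds _] /andP[Dt _]; exact: (@D_pf B 0). Qed.

Lemma mu_truncation_ge B T :
  (\sum_(0 <= k < T) weight (D B 0) k)%:E <= mu (open_class (truncation B T)).
Proof.
have := weight_partial_le mu_uniform T (@truncation_prefix_free B T).
apply: le_trans; rewrite lee_fin; apply: ler_sum_nat => k /andP[_ kT].
by rewrite /weight /truncation decodeK kT andbT.
Qed.

Lemma nearly_fullE B n T : nearly_full B n T =
  (1 - \sum_(0 <= k < T) weight (D B 0) k <= 2^-1 ^+ n :> R)%R.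
Proof.
have pos m : (0 < 2 ^+ m :> R)%R by rewrite exprn_gt0.
have ST : (\sum_(0 <= k < T) weight (D B 0) k <= 1 :> R)%R.
  rewrite -lee_fin; apply: le_trans (weight_partial_le mu_uniform T (@D_pf B 0)) _.
  exact: probability_le1 (measurable_open_class _).
have NT : (prefix_sum (D B 0) T <= 2 ^ T)%N.
  by rewrite -(ler_nat R) natrX prefix_sumE ger_pMr.
rewrite /nearly_full -(ler_nat R) natrM natrB // !natrX prefix_sumE.
rewrite -{1}[(2 ^+ T)%R]mulr1 -mulrBr -mulrA -[leRHS]mulr1 ler_pM2l //.
by rewrite exprVn -[in RHS]div1r ler_pdivlMr.
Qed.

Lemma residue_test B : ML_test mu B (fun n => open_class (residue B n)).
Proof.
split; first by exists (residue B); split=> //; apply/uniformly_re_decidable/decidable_residue.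
move=> n; case: (pselect (exists T, nearly_full B n T)) => [exT|nexT]; last first.
  have -> : open_class (residue B n) = set0.
    apply/seteqP; split=> // X /open_residueP[T nT _]; apply: nexT; by exists T.
  by rewrite measure0 lee_fin exprn_ge0 // invr_ge0.
(* The truncations increase with the stage, so the complement at the least nearly full stage
   contains all the others. *)
case: (ex_minnP exT) => T nT minT.
have mT : measurable (open_class (truncation B T) : set cantorM) := measurable_open_class _.
apply: (@le_trans _ _ (mu (~` open_class (truncation B T)))).
  apply: le_measure; rewrite ?inE.
  - exact: measurable_open_class.
  - exact: measurableC.
  move=> X /open_residueP[T' nT' XT'] XT; apply: XT'; move: XT => [s /andP[Ds sT] sX].
  by exists s => //; rewrite /truncation /= Ds (leq_trans sT) // minT.
rewrite probability_setC //; rewrite nearly_fullE in nT.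
apply: (@le_trans _ _ (1 - (\sum_(0 <= k < T) weight (D B 0) k)%:E)); last first.
  by rewrite -EFinB lee_fin.
by apply: leeB => //; exact: mu_truncation_ge.
Qed.

End full_class.

Lemma full_class_random B U X : sigma01 B U -> mu U = 1 -> random mu B X -> U X.
Proof.
move=> /sigma01_normal[D [cD pD ->]] U1 randX; apply: contrapT => XU.
apply: (randX _ (residue_test cD pD B)) => n _; apply/open_residueP.
have [|T ST] := @weight_partial_gt _ mu mu_uniform (D B 0%N) (1 - (2^-1 ^+ n)%:E) (pD B 0%N).
  by rewrite U1 -EFinB lte_fin ltrBlDr ltrDl exprn_gt0 // invr_gt0.
exists T.
  rewrite (nearly_fullE pD); move: ST; rewrite -EFinB lte_fin => /ltW.
  by rewrite lerBlDr lerBlDl.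
by move=> [s /andP[Ds _] sX]; apply: XU; exists s.
Qed.

(** ** Powers of open classes *)

Lemma mu_concat_pow_le W j : prefix_free W ->
  mu (open_class (concat_pow W j)) <= mu (open_class W) ^+ j.
Proof.
move=> pW; elim: j => [|j IH]; first exact: probability_le1 (measurable_open_class _).
have := mu_concat_le mu_uniform (@concat_pow_prefix_free W j pW) pW.
move=> /le_trans; apply.
by rewrite expeS muleC; apply: lee_pmul.
Qed.

Lemma expr_lt_eps (x e : R) : (0 <= x < 1)%R -> (0 < e)%R -> exists k, (x ^+ k < e)%R.
Proof.
move=> /andP[x0 x1] e0; have : (`|x| < 1)%R by rewrite ger0_norm.
move=> /cvg_expr /cvgr0_norm_lt /(_ e e0) [k _ /(_ k (leqnn k))] /=.
by rewrite ger0_norm ?exprn_ge0 // => xk; exists k.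
Qed.

(** Take [k] with [mu W ^ k] at most one half. The factor [n.+1] keeps the exponent from vanishing
    at [n = 0], as (5) asks for a positive one. *)
Lemma pow_test B W : re B W -> prefix_free W -> mu (open_class W) < 1 ->
  exists k, ML_test mu B (fun n => open_class (concat_pow W (k * n.+1))).
Proof.
move=> reW pW W1; have mW := measurable_open_class W.
have finW : mu (open_class W) \is a fin_num by exact: fin_num_measure.
have [||k /ltW xk] := @expr_lt_eps (fine (mu (open_class W))) 2^-1%R.
- by rewrite fine_ge0 //= -lte_fin fineK.
- by rewrite invr_gt0.
exists k; split.
  exists (fun n => concat_pow W (k * n.+1)); split=> //.
  apply: (uniformly_re_index (g := fun n => (k * n.+1)%N)); first by comp_arith.
  exact: uniformly_re_concat_pow.
move=> n; apply: le_trans (mu_concat_pow_le _ pW) _.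
rewrite -(fineK finW) -EFin_expe lee_fin exprM.
apply: (@le_trans _ _ (2^-1 ^+ n.+1)%R).
  by apply: lerXn2r => //; rewrite nnegrE ?exprn_ge0 ?fine_ge0.
by apply: ler_wiXn2l; rewrite ?invr_ge0 ?invf_le1 ?ler1n.
Qed.

End classes.

Section reductions.
Context {R : realType} (mu : probability cantorM R).
Hypothesis mu_uniform : uniform_measure mu.

Local Open Scope ring_scope.
Local Open Scope ereal_scope.

Definition residual (D : string -> bool) (s : string) : string -> bool :=
  fun t => has_prefix D (s ++ t).

Lemma open_residual (D : string -> bool) s Y :
  open_class (residual D s) Y <-> open_class D (prepend s Y).
Proof. by rewrite open_prepend. Qed.

Lemma sigma01_residual A (D : cantor_space -> nat -> string -> bool) s :
  decidable_family D -> sigma01 A (open_class (residual (D A 0%N) s)).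
Proof.
move=> cD; exists (residual (D A 0%N) s); split=> //.
apply: (re_decidable (P := fun B => residual (D B 0%N) s)).
by apply: computable_has_prefix => //; comp_arith.
Qed.

(** ** Dense strings *)

Section density.
Variable D : cantor_space -> nat -> string -> bool.
Hypothesis D_dec : decidable_family D.
Hypothesis D_pf : forall B m, prefix_free (D B m).

Definition residual_generators B s : string -> bool := first_hit (residual (D B 0%N) s).

Definition dense B k : set string :=
  [set s | (1 - 2^-1 ^+ k)%:E < mu (open_class (residual (D B 0%N) s))].

(** A strict lower bound on the measure of an enumerable open class is already witnessed by a finite
    partial sum. *)
Lemma re_dense B k : re B (dense B k).
Proof.
apply: (re_enum (P := fun B v => (2 ^ nth 0 v 0 * (2 ^ k - 1) <
  prefix_sum (residual_generators B (decode (nth 0 v 1))) (nth 0 v 0) * 2 ^ k)%N)).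
  apply: computable_leq; first by comp_arith.
  apply: computable_mul; last by comp_arith.
  apply: (computable_prefix_sum
    (D := fun B v => residual_generators B (decode (nth 0%N v 1)))); last by comp_arith.
  apply: (computable_first_hit (H := fun B v => residual (D B 0%N)
    (decode (nth 0%N (behead v) 1)))).
  - by move=> S' cS; apply: computable_has_prefix => //; comp_arith; exact: cS.
  - by apply: computable_has_prefix => //; comp_arith.
  - by comp_arith.
have pos m : (0 < 2 ^+ m :> R)%R by rewrite exprn_gt0.
have E T s : (2 ^ T * (2 ^ k - 1) < prefix_sum (residual_generators B s) T * 2 ^ k)%N =
    (1 - 2^-1 ^+ k < \sum_(0 <= i < T) weight (residual_generators B s) i :> R)%R.
  rewrite -(ltr_nat R) !natrM natrB ?expn_gt0 // !natrX prefix_sumE -mulrA ltr_pM2l //.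
  by rewrite exprVn -ltr_pdivrMr // mulrBl mul1r divff ?gt_eqF.
move=> s; rewrite /dense /=; split.
  rewrite -open_first_hit => /weight_partial_gt.
  move=> /(_ mu_uniform (@first_hit_prefix_free _))[T HT].
  by exists T; rewrite codeK E -lte_fin.
move=> [T]; rewrite codeK E -lte_fin => /lt_le_trans; apply.
by rewrite -open_first_hit; apply: weight_partial_le => //; exact: first_hit_prefix_free.
Qed.

(** The cylinders of [H] are disjoint, and by [mu_shift] each contributes to [G] at least the
    fraction [q] of its own measure. *)
Lemma density_bound (H : string -> bool) (G : string -> bool) (q : R) : (0 <= q)%R ->
  prefix_free H -> (forall s, H s -> q%:E <= mu (open_class (residual G s))) ->
  q%:E * mu (open_class H) <= mu (open_class G).
Proof.
move=> q0 pH Hq.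
have mF k : measurable (open_class G `&` piece [::] H k : set cantorM).
  by apply: measurableI; [exact: measurable_open_class|exact: measurable_piece].
apply: (@le_trans _ _ (mu (\bigcup_k (open_class G `&` piece [::] H k)))); last first.
  apply: le_measure; rewrite ?inE; [exact: bigcupT_measurable|exact: measurable_open_class|].
  by move=> X [k _ []].
rewrite measure_bigcup //; last first.
  apply/trivIsetP => i j _ _ ij; have /trivIsetP := @trivIset_piece [::] _ pH.
  move=> /(_ i j I I ij) ijE; rewrite setIACA ijE; exact: setI0.
rewrite mu_open_class // -nneseriesZl; last by move=> k _; rewrite lee_fin weight_ge0.
rewrite [leRHS](eq_eseriesl (Q := xpredT)); last by move=> k; rewrite in_setT.
apply: lee_nneseries => k _; first by rewrite -EFinM lee_fin mulr_ge0 // weight_ge0.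
rewrite /piece /weight; case: ifP => Hk; last by rewrite setI0 measure0 mule0.
apply: (@le_trans _ _ (mu (open_class G `&` cylinder (decode k)))) => //.
by rewrite mu_shift // muleC; apply: lee_pmul => //; exact: Hq.
Qed.

Lemma mu_dense_lt1 B : mu (open_class (D B 0%N)) < 1 -> exists k, mu (open_class (dense B k)) < 1.
Proof.
move=> G1; have mG := measurable_open_class (D B 0%N).
have finG : mu (open_class (D B 0%N)) \is a fin_num by exact: fin_num_measure.
set g := fine (mu (open_class (D B 0%N))).
have g0 : (0 <= g)%R by rewrite fine_ge0.
have g1 : (g < 1)%R by rewrite -lte_fin fineK.
have [||k gk] := @expr_lt_eps R 2^-1%R (1 - g)%R.
- by rewrite invr_ge0 ler0n invf_lt1 ?ltr1n.
- by rewrite subr_gt0.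
(* With [2 ^ - k < 1 - g] the bound reads [q * mu (dense) <= g < q], which forces measure below
   1. *)
exists k; pose q : R := (1 - 2^-1 ^+ k)%R; have gq : (g < q)%R by rewrite /q ltrBrDr addrC -ltrBrDr.
have q0 : (0 < q)%R := le_lt_trans g0 gq.
have [H HE] := set_bool (dense B k).
have := @density_bound (first_hit H) (D B 0%N) q (ltW q0) (@first_hit_prefix_free _).
rewrite open_first_hit HE => Hq; rewrite -(lte_pmul2l _ (_ : 0 < q%:E)) ?lte_fin // mule1.
apply: le_lt_trans (Hq _) _; last by rewrite -(fineK finG) lte_fin.
move=> s /first_hitP[Hs _]; apply: ltW.
suff : dense B k s by [].
by rewrite HE.
Qed.
End density.

(* If some [sigma] in [W ^ (n + 1)] has [mu (G | sigma) < 1] then [G | sigma] covers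
   [open_class W]; otherwise [W ^ (n + 1)] consists of dense strings, whose class still
   has measure below [1]. *)
Lemma concat_pow_cover (W : set string) B n G :
  sigma_mu1 mu B G -> open_class (concat_pow W n.+1) `<=` G ->
  exists2 G', sigma_mu1 mu B G' & open_class W `<=` G'.
Proof.
elim: n G => [|n IH] G [G01 G1] WG.
  exists G => // X [s Ws sX]; apply: WG; exists s => //.
  by exists [::], s.
have [D [D_dec D_pf GE]] := sigma01_normal G01.
case: (pselect (exists2 s, concat_pow W n.+1 s &
    mu (open_class (residual (D B 0%N) s)) < 1)) => [[s Ws s1]|full].
  exists (open_class (residual (D B 0%N) s)).
    by split=> //; exact: sigma01_residual.
  move=> Y [t Wt tY]; apply/open_residual; rewrite -GE; apply: WG.
  exists (s ++ t); first by exists s, t.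
  by apply/cylinder_cat; exists Y.
have [k k1] : exists k, mu (open_class (dense D B k)) < 1.
  by apply: mu_dense_lt1 => //; rewrite -GE.
apply: (IH (open_class (dense D B k))).
  by split=> //; exists (dense D B k); split=> //; exact: re_dense.
move=> X [s Ws sX]; exists s => //; rewrite /dense /=.
apply: (@lt_le_trans _ _ 1).
  by rewrite lte_fin ltrBlDr ltrDl exprn_gt0 // invr_gt0.
by rewrite leNgt; apply/negP => s1; apply: full; exists s.
Qed.

(** * Tails *)

(** Conditioning on [cylinder s] multiplies measures by at most [2 ^ size s]; shifting the test
    index by [size s] absorbs this. *)
Lemma random_prepend A s Y : random mu A Y -> random mu A (prepend s Y).
Proof.
move=> randY V [[W [reW VW]] smallV] VX.
have [D [D_dec _ DW]] := uniformly_re_normal reW.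
apply: (randY (fun n => open_class (residual (D A (n + size s)%N) s))); last first.
  by move=> n _; apply/open_residual; rewrite -DW -VW; exact: VX.
split.
  exists (fun n => residual (D A (n + size s)%N) s); split=> //.
  apply: (uniformly_re_decidable (P := fun B n => residual (D B (n + size s)%N) s)).
  by apply: computable_has_prefix => //; comp_arith.
move=> n; have := mu_shift mu_uniform (D A (n + size s)%N) s.
have pos m : (0 < 2^-1 ^+ m :> R)%R by rewrite exprn_gt0 // invr_gt0.
move=> E; rewrite -(lee_pmul2l _ (_ : 0 < (2^-1 ^+ size s)%:E)) ?lte_fin // -E.
rewrite -EFinM -exprD addnC; apply: le_trans (smallV _).
rewrite VW DW; apply: le_measure; rewrite ?inE.
- by apply: measurableI; [exact: measurable_open_class|exact: measurable_cylinder].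
- exact: measurable_open_class.
- by move=> X [].
Qed.

(* Kucera: a random real all of whose tails avoid [P] would lie in all powers of [~` P]. *)
Lemma random_tail B P X : pi_mu1 mu B P -> random mu B X ->
  exists s Y, X = prepend s Y /\ P Y.
Proof.
move=> [P01 P1] randX; apply: contrapT => noP.
have [D [D_dec D_pf PE]] := sigma01_normal P01.
have [k testk] : exists k, ML_test mu B (fun n => open_class (concat_pow (D B 0%N) (k * n.+1))).
  apply: pow_test => //; last by rewrite -PE.
  apply: (re_decidable (P := fun B => D B 0%N)).
  by apply: computable_family => //; comp_arith.
(* Beyond a string of the [j]-th power the tail is again outside [P], hence begins with another
   generator. *)
apply: (randX _ testk) => n _; elim: (k * n.+1)%N => {n} [|j [s Ds sX]].
  by exists [::].
have [Y XY] := cylinder_prependP sX.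
have : (~` P) Y by move=> PY; apply: noP; exists s, Y.
rewrite PE => -[t Dt tY]; exists (s ++ t); first by exists s, t.
by rewrite XY; apply/cylinder_cat; exists Y.
Qed.

(** * Closed subclasses *)

Lemma S_class_sigma_mu1 U A : prefix_free_machine U -> sigma_mu1 mu A (S_class U A 1).
Proof.
move=> pU; split.
  eexists; split; last exact: S_classE.
  exact: (uniformly_re_re 1%N (uniformly_re_S_class U A)).
have [_ /(_ 1%N) S1] := S_class_test mu_uniform A pU.
by apply: le_lt_trans S1 _; rewrite lte_fin expr1 invf_lt1 // ltr1n.
Qed.

(** If the intersection were null, its complement would be an effectively open class of measure 1
    and contain every random real, yet the intersection contains one. *)
Lemma pi_mu1_restrict B Q s : pi_mu1 mu B Q -> Q `<=` random mu B ->
  Q `&` cylinder s <> set0 -> pi_mu1 mu B (Q `&` cylinder s).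
Proof.
move=> [Q01 _] Qrand Qs.
have QE : sigma01 B (~` (Q `&` cylinder s)).
  have [D [D_dec D_pf QE]] := sigma01_normal Q01.
  (* The complement of [cylinder s] is generated by the other strings of the same length. *)
  pose P B' t := D B' 0%N t || (size t == size s) && (t != s).
  exists (P B); split.
    apply: re_decidable; apply: computable_or.
      by apply: computable_family => //; comp_arith.
    apply: computable_and; first by apply: computable_eq; comp_arith.
    by apply: computable_neg; apply: computable_seq_eq; comp_arith.
  rewrite setCI QE; apply/seteqP; split=> X.
    move=> [[t Dt tX]|sX]; first by exists t => //; rewrite /P /= Dt.
    apply/open_classP; exists (size s); rewrite /P size_restr eqxx /=.
    by apply/orP; right; apply/eqP.
  move=> [t /orP[Dt|/andP[/eqP ts /eqP st]] tX]; first by left; exists t.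
  by right => sX; apply: st; rewrite -(tX : _ = t) ts.
split=> //; have [X [QX sX]] : (Q `&` cylinder s) !=set0 by apply/set0P/eqP.
have [D [_ _ DE]] := sigma01_normal QE.
have mQ : measurable (~` (Q `&` cylinder s) : set cantorM).
  by rewrite DE; exact: measurable_open_class.
rewrite lt_neqAle probability_le1 // andbT; apply/eqP => full.
by have := full_class_random mu_uniform QE full (Qrand X QX); apply.
Qed.

Lemma pi_mu1_closed B Q X : pi_mu1 mu B Q ->
  (forall m, exists Y, Q Y /\ restr Y m = restr X m) -> Q X.
Proof.
move=> [[W [_ QE]] _] H; apply: contrapT => QX.
have : (~` Q) X by [].
rewrite QE => /open_classP[m Wm]; have [Y [QY YX]] := H m.
have : (~` Q) Y by rewrite QE; apply/open_classP; exists m; rewrite YX.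
by [].
Qed.

End reductions.

(** * Baire category in a closed class *)

Lemma cylinder_limit (s : nat -> string) :
  (forall k, prefix (s k) (s k.+1)) -> (forall k, k <= size (s k)) ->
  exists X, forall k, cylinder (s k) X.
Proof.
move=> sS sz; have sle j k : j <= k -> prefix (s j) (s k).
  elim: k => [|k IH]; first by rewrite leqn0 => /eqP ->; exact: prefix_refl.
  rewrite leq_eqVlt => /predU1P[->|/IH jk]; first exact: prefix_refl.
  exact: prefix_trans jk (sS k).
have nth_s j k i : i < size (s j) -> i < size (s k) -> nth false (s j) i = nth false (s k) i.
  wlog jk : j k / j <= k.
    by move=> H ij ik; case: (leqP j k) => [|/ltnW] jk; [|symmetry]; apply: H.
  by move=> ij _; have /prefixP[u ->] := sle _ _ jk; rewrite nth_cat ij.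
exists (fun i => nth false (s i.+1) i) => k.
apply: (@eq_from_nth _ false); rewrite size_restr // => i ik.
by rewrite nth_mkseq //; apply: nth_s.
Qed.

(** Strings that still meet [Q] are extended so as to enter one dense open class after another;
    closedness puts the limit in [Q]. *)
Lemma generic_point (Q : set cantor_space) (W : nat -> set string) : Q !=set0 ->
  (forall X, (forall m, exists Y, Q Y /\ restr Y m = restr X m) -> Q X) ->
  (forall s n, Q `&` cylinder s !=set0 -> Q `&` open_class (W n) `&` cylinder s !=set0) ->
  exists X, Q X /\ forall n, open_class (W n) X.
Proof.
move=> [X0 QX0] Qclosed QW.
have /choice[f Hf] (x : nat * string) : exists t, Q `&` cylinder x.2 !=set0 ->
    [/\ Q `&` cylinder t !=set0, prefix x.2 t, size x.2 < size t &
        cylinder t `<=` open_class (W x.1)].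
  (* Strings whose cylinder misses [Q] get a junk value; the construction never reaches them. *)
  case: x => n s /=; case: (pselect (Q `&` cylinder s !=set0)) => [Qs|]; last by exists [::].
  have [Y [[QY [w Ww wY]] sY]] := QW s n Qs.
  set m := maxn (size s).+1 (size w).
  have sm : size s < m by rewrite /m leq_maxl.
  exists (restr Y m) => _; split; last 1 first.
  - move=> X YX; exists w => //; apply: prefix_cylinder YX.
    by apply: cylinder_prefix wY (cylinder_restr Y m) _; rewrite size_restr leq_maxr.
  - by exists Y; split=> //; exact: cylinder_restr.
  - by apply: cylinder_prefix sY (cylinder_restr Y m) _; rewrite size_restr ltnW.
  - by rewrite size_restr.
pose s := nat_rect (fun _ => string) [::] (fun k t => f (k, t)).
have Qs k : Q `&` cylinder (s k) !=set0.
  elim: k => [|k IH]; first by exists X0.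
  by have [] := Hf (k, s k) IH.
have Hs k := Hf (k, s k) (Qs k).
have ss k : prefix (s k) (s k.+1) by have [_ ? _ _] := Hs k.
have sz k : k <= size (s k).
  by elim: k => // k IH; have [_ _ sk _] := Hs k; exact: leq_ltn_trans IH sk.
have [X sX] := cylinder_limit ss sz; exists X; split; last first.
  by move=> n; have [_ _ _ Wn] := Hs n; apply: Wn; exact: (sX n.+1).
apply: Qclosed => m; have [Y [QY sY]] := Qs m; exists Y; split=> //.
rewrite -(@restr_take Y m (size (s m))) // -(@restr_take X m (size (s m))) //.
by rewrite (sY : _ = s m) (sX m : _ = s m).
Qed.

Theorem theorem2p10 (R : realType) (mu : probability cantorM R)
    (mu_uniform : uniform_measure mu)
    (U : prog) (U_universal : universal_machine U)
    (A : cantor_space)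
    (gen : set cantor_space -> set string)
    (gen_choice : generator_choice A gen) :
  [<->
    (random mu empty_oracle `<=` random mu A);
    (forall Q, pi_mu1 mu empty_oracle Q -> Q `<=` random mu empty_oracle ->
       exists (s : string) (n : nat),
         Q `&` cylinder s <> set0 /\
         Q `&` S_class U A n `&` cylinder s = set0);
    (exists n, has_pi_mu1_subclass mu (~` S_class U A n));
    (forall V, ML_test mu A V ->
       exists n, has_pi_mu1_subclass mu (~` V n));
    (forall Q, pi_mu1 mu A Q ->
       exists n, (1 <= n)%N /\ has_pi_mu1_subclass mu (closed_pow gen Q n));
    (forall Q, pi_mu1 mu A Q -> has_pi_mu1_subclass mu Q);
    (exists Q, [/\ pi_mu1 mu A Q, Q `<=` random mu A &
                   has_pi_mu1_subclass mu Q]);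
    has_pi_mu1_subclass mu (random mu A)].
Proof.
have pfU := U_universal.1.
tfae.
- move=> low Q piQ Qrand; apply: contrapT => none.
  have [X [QX SX]] : exists X, Q X /\ forall n, S_class U A n X.
    have [|||X [QX WX]] := @generic_point Q (fun n =>
      [set s | exists p, runs U A p s /\ size p + n <= size s]).
    + apply/set0P/eqP => Q0; case: piQ; rewrite Q0 setC0 => _.
      by rewrite probability_setT ltxx.
    + by move=> X; exact: pi_mu1_closed piQ.
    + move=> s n /set0P/eqP Qs; apply/set0P/eqP => QSs; apply: none.
      by exists s, n; split=> //; rewrite S_classE.
    + by exists X; split=> // n; rewrite S_classE.
  by apply: (low X (Qrand X QX) _ (S_class_test mu_uniform A pfU)) => n _.
- move=> H2.
  have randS := @compl_S_class_random _ _ mu_uniform U empty_oracle 1 U_universal.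
  have piS : pi_mu1 mu empty_oracle (~` S_class U empty_oracle 1).
    by rewrite /pi_mu1 setCK; exact: S_class_sigma_mu1.
  have [s [n [Qs QSs]]] := H2 _ piS randS.
  exists n, (~` S_class U empty_oracle 1 `&` cylinder s); split.
    exact: pi_mu1_restrict.
  by move=> X [QX sX] SX; suff : (set0 : set cantor_space) X by []; rewrite -QSs.
- move=> [n [P [piP PS]]] V testV.
  have [m VS] := test_sub_S_class mu_uniform n U_universal testV.
  by exists m, P; split=> // X /PS SX /VS.
- move=> H4 Q [Q01 Q1]; have [pgen regen genE] := gen_choice _ Q01.
  have [|k testk] := pow_test mu_uniform regen pgen; first by rewrite -genE.
  have [n [P [piP PV]]] := H4 _ testk.
  exists (k * n.+1); split; last by exists P.
  (* For [k = 0] the power would be generated by the empty string, so [P] would be empty and its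
     complement of measure 1. *)
  rewrite muln_gt0 andbT lt0n; apply/eqP => k0; have [_] := piP.
  suff -> : P = set0 by rewrite setC0 probability_setT ltxx.
  rewrite -subset0 => X /PV; apply; rewrite k0 mul0n.
  by exists [::].
- move=> H5 Q piQ; have [[|n] [//= _ [P [piP PQ]]]] := H5 Q piQ.
  have [pgen regen genE] := gen_choice _ piQ.1.
  have [|G sG WG] := concat_pow_cover (n := n) mu_uniform piP (W := gen (~` Q)).
    by move=> X WX PX; exact: (PQ X PX).
  exists (~` G); split; first by rewrite /pi_mu1 setCK.
  by move=> X GX; apply: contrapT => QX; apply: GX; apply: WG; rewrite -genE.
- move=> H6; have piS : pi_mu1 mu A (~` S_class U A 1).
    by rewrite /pi_mu1 setCK; exact: S_class_sigma_mu1.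
  exists (~` S_class U A 1); split=> //; last exact: H6.
  exact: compl_S_class_random.
- move=> [Q [_ Qrand [P [piP PQ]]]]; exists P; split=> // X /PQ; exact: Qrand.
- move=> [P [piP Prand]] X randX.
  have [s [Y [-> PY]]] := random_tail mu_uniform piP randX.
  by apply: random_prepend => //; exact: Prand.
Qed.
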